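(* Let $s>0$ and $n\ge1$. Let $G$ be a finite graph, every edge of which has length at least $s$, such that every connected component $C$ of $G$ satisfies $\mathrm{FvsNum}(C)\le1$. Let $N=\min(n+\mathrm{FvsNum}(G),\,2n-1)$. Then for any $n$ agents with monotone (continuous, nonnegative) valuations, there is an $s$-separated allocation $(A_1,\dots,A_n)$ with $v_i(A_i)\ge\mathrm{MMS}_i^{N,s}$ for every $i\in[n]$.
   Context: Cake model: the cake is a finite undirected graph $G$, possibly disconnected, in which every edge is a segment of positive length; points of $G$ are its vertices and the points on its edges. A piece of cake is a finite union of intervals contained in edges, together possibly with some vertices. A piece $X$ is connected if any two points of $X$ can be joined by a path in $G$ that stays inside $X$. Each agent $i$ has a valuation $v_i$ on pieces that is nonnegative, monotone and continuous; in particular, points have value $0$. Distances: $\mathrm{Dist}^G(x,y)$ is the length of a shortest path along the edges, and is $\infty$ if $x$ and $y$ lie in different components. For sets, $\mathrm{Dist}^G(X,Y)=\inf_{x\in X,y\in Y}\mathrm{Dist}^G(x,y)$. Separation: a $k$-partition is $s$-separated if it consists of $k$ pairwise disjoint connected pieces $P_1,\dots,P_k$ with $\mathrm{Dist}^G(P_i,P_j)\ge s$ for $i\ne j$. An $s$-separated allocation is a vector of connected pieces satisfying the same condition. Maximin share: $\mathrm{MMS}_i^{k,s}=\sup\min_{j\in[k]}v_i(P_j)$, where the supremum ranges over $s$-separated $k$-partitions. $\mathrm{FvsNum}(H)$ is the minimum number of vertices whose removal from $H$ leaves an acyclic graph. *)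

(* Defs.v *)
From HB Require Import structures.
From mathcomp Require Import all_boot all_order all_algebra.
From mathcomp Require Import all_classical all_reals all_analysis.
Set Implicit Arguments. Unset Strict Implicit. Unset Printing Implicit Defensive.
Import Order.TTheory GRing.Theory Num.Theory.
Local Open Scope classical_set_scope.
Local Open Scope ring_scope.

(* The cake: a finite (multi)graph given by a finite vertex type V,    *)
(* a finite edge type E, endpoints [ends e = (a, b)] and lengths       *)
(* [len e].  Edge e is the segment [0, len e], with parameter 0 being  *)
(* the vertex (ends e).1 and parameter len e the vertex (ends e).2.    *)
(* Points of the cake are vertices [PV v] and interior edge points     *)
(* [PE e t] with 0 < t < len e.                                         *)

Inductive cake_pt (R : Type) (V E : Type) : Type :=
  | PV of V
  | PE of E & R.
Arguments PV {R V E} _.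
Arguments PE {R V E} _ _.

Section Cake.
Context {R : realType} {V E : finType} (ends : E -> V * V) (len : E -> R).

Local Notation point := (cake_pt R V E).

Definition pt_at (e : E) (t : R) : point :=
  if t <= 0 then PV (ends e).1
  else if len e <= t then PV (ends e).2
  else PE e t.

Definition seg (e : E) (a b : R) : set point :=
  [set pt_at e t | t in [set t | Num.min a b <= t <= Num.max a b /\ 0 <= t <= len e]].

Definition cake : set point :=
  [set PV v | v in [set: V]] `|` \bigcup_(e in [set: E]) seg e 0 (len e).

Definition is_piece (X : set point) : Prop :=
  exists (l : seq (E * interval R)) (W : {set V}),
    (forall ei, ei \in l -> [set` ei.2] `<=` [set t | 0 <= t <= len ei.1]) /\
    X = (\bigcup_(ei in [set ei | ei \in l]) [set pt_at ei.1 t | t in [set` ei.2]])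
        `|` [set PV v | v in [set w | w \in W]].

Fixpoint is_walk (a b : V) (s : seq E) : Prop :=
  match s with
  | [::] => a = b
  | e :: s' => exists x, (ends e = (a, x) \/ ends e = (x, a)) /\ is_walk x b s'
  end.

Definition distV (a b : V) : \bar R :=
  ereal_inf [set (\sum_(e <- s) len e)%:E | s in [set s | is_walk a b s]].

Definition rep (x : point) (e : E) (t : R) : Prop :=
  0 <= t <= len e /\ pt_at e t = x.

Definition leg (x : point) (a : V) (d : R) : Prop :=
  (x = PV a /\ d = 0) \/
  exists e t, rep x e t /\
     (((ends e).1 = a /\ d = t) \/ ((ends e).2 = a /\ d = len e - t)).

(* Dist^G(x, y): length of a shortest path along the edges, +oo if x, y
   lie in different components. A path either stays inside one edge, or
   goes from x to a vertex a along its edge, then along a walk to a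
   vertex b, then to y along its edge. *)
Definition Dist (x y : point) : \bar R :=
  ereal_inf ([set z | exists e t t', rep x e t /\ rep y e t' /\ z = (`|t - t'|)%:E]
             `|` [set z | exists a b d1 d2, leg x a d1 /\ leg y b d2 /\
                            z = (d1%:E + distV a b + d2%:E)%E]).

Definition DistS (X Y : set point) : \bar R :=
  ereal_inf [set Dist x y | x in X & y in Y].

(* Connectedness of a piece: any two points of X can be joined by a path
   in G that stays inside X.  Such a path either runs inside a single edge,
   or goes from x to a vertex a along its edge, through a walk of whole
   edges, and from a vertex b to y along its edge. *)
Definition reach_in (X : set point) (x : point) (a : V) : Prop :=
  x = PV a \/
  exists e t, rep x e t /\
    (((ends e).1 = a /\ seg e 0 t `<=` X) \/ ((ends e).2 = a /\ seg e t (len e) `<=` X)).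

Definition path_in (X : set point) (x y : point) : Prop :=
  x = y \/
  (exists e t t', rep x e t /\ rep y e t' /\ seg e t t' `<=` X) \/
  (exists a b (s : seq E), reach_in X x a /\ reach_in X y b /\ is_walk a b s /\
      (forall e, e \in s -> seg e 0 (len e) `<=` X)).

Definition connected_piece (X : set point) : Prop :=
  is_piece X /\ forall x y, X x -> X y -> path_in X x y.

Definition cake_length (X : set point) : \bar R :=
  (\sum_(e : E) (@lebesgue_measure R) [set t : R | (0 < t < len e)%R /\ X (PE e t)])%E.

Definition is_valuation (v : set point -> R) : Prop :=
  [/\ (forall X, is_piece X -> 0 <= v X),
      (forall X Y, is_piece X -> is_piece Y -> X `<=` Y -> v X <= v Y),
      (forall X, is_piece X -> forall eps : R, 0 < eps -> exists2 delta : R, 0 < delta &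
          forall Y, is_piece Y -> (cake_length ((X `\` Y) `|` (Y `\` X)) < delta%:E)%E ->
             `|v X - v Y| < eps) &
      (forall x, cake x -> v [set x] = 0)].

Definition s_separated (I : finType) (s : R) (P : I -> set point) : Prop :=
  (forall j, connected_piece (P j)) /\
  (forall j j', j != j' -> P j `&` P j' = set0 /\ (s%:E <= DistS (P j) (P j'))%E).

Definition MMS (v : set point -> R) (k : nat) (s : R) : \bar R :=
  ereal_sup [set \big[Order.min/+oo%E]_(j < k) (v (P j))%:E
            | P in [set P : 'I_k -> set point | s_separated s P]].

Definition adj : rel V :=
  fun a b => [exists e, (ends e == (a, b)) || (ends e == (b, a))].

Definition component (a : V) : {set V} := [set b | connect adj a b].

Definition has_cycle_in (W : {set V}) : Prop :=
  exists (a : V) (s : seq E), s != [::] /\ uniq s /\ is_walk a a s /\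
    (forall e, e \in s -> ((ends e).1 \in W) && ((ends e).2 \in W)).

Definition fvs_num (W : {set V}) : nat :=
  \big[minn/#|W|]_(S : {set V} | (S \subset W) && `[< ~ has_cycle_in (W :\: S) >]) #|S|.
End Cake.

(* Main.v *)
Require Import Defs.
From HB Require Import structures.
From mathcomp Require Import all_boot all_order all_algebra.
From mathcomp Require Import all_classical all_reals all_analysis.
From mathcomp Require Import zify lra ring.
Set Implicit Arguments. Unset Strict Implicit. Unset Printing Implicit Defensive.
Import Order.TTheory GRing.Theory Num.Theory.

(* The grid.  Subdivide every edge into cells whose lengths lie between s/M and
   s/(M-1).  A piece is rounded up to the set of vertices and cells it meets; for
   large M this changes distances by O(s/M) only, and the value does not decrease.
   So it suffices to find allocations in finite graphs, for the hop distance, and to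
   let M tend to infinity: closed connected sets are described by a combinatorial
   type and the lengths of the pieces of edges they contain, so a cluster point along
   an ultrafilter exists, and valuations and separation pass to the limit.

   The finite graph.  Call a set acceptable to an agent if it is worth at least one of
   the parts of her partition.  In a rooted forest, give the deepest acceptable subtree
   to an agent who accepts it: among the parts of another agent, no two can both be
   close to it, because following the branches up to common ancestors would make
   them close to each other.  So each agent loses at most one part.

   A component with a feedback vertex w becomes a forest once the open ball of radius
   r/2 around w is removed; two sets off the ball that are separated in the forest
   stay separated in the graph, and a separated family has at most one member meeting
   the ball.  If some agent accepts a set in this forest, one deepest subtree is handed
   out and the others lose at most two parts.  Otherwise every part inside the
   component meets the ball, so each agent has at most one there, and the whole
   component can be spent on one agent, or discarded.  Induction keeps the number
   of remaining parts at least min(m + f, 2m - 1), with m agents and f untouched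
   feedback vertices. *)

(** * Separated allocations in a finite graph *)

(** Bookkeeping for the invariant [min(m + f, 2m - 1)]: serving one agent and spending one feedback
    vertex lowers both terms by two (up to truncation at zero), which pays for two lost parts. In
    [minn_lose1] only an agent leaves, which pays for one part. *)
Lemma minn_lose2 m z a b : (minn (m + z.+1) (2 * m - 1) <= a)%N -> (a <= b.+2)%N ->
  (minn (m.-1 + z) (2 * m.-1 - 1) <= b)%N.
Proof.
case: m => [|m]; first by rewrite muln0 minn0.
by rewrite !geq_min => /orP[] ? ?; apply/orP; [left|right]; lia.
Qed.

Lemma minn_mono2 a a' b : (a <= a')%N -> (minn a b <= minn a' b)%N.
Proof. by move=> aa'; rewrite leq_min geq_minr andbT geq_min aa'. Qed.

Lemma minn_lose1 m z a b : (minn (m + z) (2 * m - 1) <= a)%N -> (a <= b.+1)%N ->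
  (minn (m.-1 + z) (2 * m.-1 - 1) <= b)%N.
Proof.
case: m => [|m]; first by rewrite muln0 minn0.
by rewrite !geq_min => /orP[] ? ?; apply/orP; [left|right]; lia.
Qed.

Section Walks.
Context {T : finType} (e : rel T).

(** [m] only bounds the number of hops from above, so that walks can be weakened and concatenated
    freely; [Q] constrains both ends as well. *)
Definition joined (Q : pred T) (m : nat) (x y : T) : Prop :=
  exists p, [/\ path e x p, last x p = y, (size p <= m)%N & all Q (x :: p)].

Definition conn (X : {set T}) : Prop :=
  forall x y, x \in X -> y \in X -> exists m, joined (mem X) m x y.

Definition close_sets (r : nat) (X Y : {set T}) : Prop :=
  exists x y m, [/\ x \in X, y \in Y, (m < r)%N & joined predT m x y].

Lemma joined_refl (Q : pred T) x : Q x -> joined Q 0 x x.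
Proof. by move=> Qx; exists [::]; split=> //=; rewrite Qx. Qed.

Lemma joined1 (Q : pred T) x y : e x y -> Q x -> Q y -> joined Q 1 x y.
Proof. by move=> xy Qx Qy; exists [:: y]; split=> //=; rewrite ?xy ?Qx ?Qy. Qed.

Lemma joined_mono (Q Q' : pred T) m m' x y :
  (m <= m')%N -> (forall z, Q z -> Q' z) -> joined Q m x y -> joined Q' m' x y.
Proof.
move=> mm' QQ' [p [xp py pm Qp]]; exists p; split=> //; first exact: leq_trans mm'.
by apply/allP => z /(allP Qp); apply: QQ'.
Qed.

Lemma joined_trans (Q : pred T) m m' x y z :
  joined Q m x y -> joined Q m' y z -> joined Q (m + m') x z.
Proof.
move=> [p [xp py pm Qp]] [q [yq qz qm Qq]]; exists (p ++ q); split.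
- by rewrite cat_path xp py yq.
- by rewrite last_cat py qz.
- by rewrite size_cat leq_add.
- by move: Qp Qq => /= /andP[-> ap] /andP[_ aq]; rewrite all_cat ap aq.
Qed.

Hypothesis esym : symmetric e.

Lemma joined_sym (Q : pred T) m x y : joined Q m x y -> joined Q m y x.
Proof.
move=> [p [xp py pm Qp]]; exists (rev (belast x p)); split.
- rewrite -py rev_path; apply: sub_path xp => a b; by rewrite esym.
- by case: p {xp pm Qp} py => [|a p] //= _; rewrite rev_cons last_rcons.
- by rewrite size_rev size_belast.
- apply/allP => z; rewrite -py inE mem_rev => /orP[/eqP->|/mem_belast zp].
    exact: (allP Qp) (mem_last _ _).
  exact: (allP Qp).
Qed.

Lemma joined_connect (Q : pred T) m x y : joined Q m x y -> connect e x y.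
Proof. by move=> [p [xp py _ _]]; apply/connectP; exists p. Qed.

Lemma conn0 : conn finset.set0.
Proof. by move=> x y; rewrite finset.inE. Qed.

Lemma conn_center (X : {set T}) c :
  (forall x, x \in X -> exists m, joined (mem X) m x c) -> conn X.
Proof.
move=> H x y /H[m xm] /H[m' ym]; exists (m + m')%N.
by apply: joined_trans xm _; apply: joined_sym.
Qed.

Lemma conn_sub_component (X : {set T}) w x :
  conn X -> x \in X -> connect e w x -> forall y, y \in X -> connect e w y.
Proof.
move=> cX xX wx y yX; have [m xy] := cX _ _ xX yX.
exact: connect_trans wx (joined_connect xy).
Qed.

Lemma close_sets_sym r X Y : close_sets r X Y -> close_sets r Y X.
Proof. by move=> [x [y [m [*]]]]; exists y, x, m; split=> //; exact: joined_sym. Qed.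

End Walks.

(** * Rooted forests, given by a parent map that fixes the roots *)

Section Forest.
Context {T : finType} (e : rel T) (Z : {set T}) (par : T -> T) (depth : T -> nat) (r : nat).
Hypothesis esym : symmetric e.
Hypothesis r_gt0 : (0 < r)%N.
Hypothesis par_edge : forall x, par x = x \/ e x (par x).
Hypothesis edge_par : forall x y, e x y -> [\/ x \in Z, y \in Z, par x = y | par y = x].
Hypothesis depth_par : forall x, par x = x \/ depth x = (depth (par x)).+1.

Let fadj : rel T := fun x y => (par x == y) || (par y == x).

Lemma depth_iter k x : (depth (iter k par x) <= depth x <= depth (iter k par x) + k)%N.
Proof.
elim: k => [|k IH] /=; first by rewrite addn0 leqnn.
by case: (depth_par (iter k par x)) => E; rewrite ?E; lia.
Qed.

(** Climbing stalls at a root, so [j] may count idle steps; [j'] counts the real ones, each of which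
    lowers the depth by exactly one. *)
Lemma depth_ancestor x a j : iter j par x = a ->
  exists2 j', (j' <= j)%N & iter j' par x = a /\ depth x = (depth a + j')%N.
Proof.
elim: j x => [|j IH] x; first by move=> <-; exists 0%N => //=; rewrite addn0.
rewrite iterSr => /IH [j' j'j [ja da]].
case: (depth_par x) => E; first by move: ja da; rewrite E => ja da; exists j'; rewrite // leqW.
by exists j'.+1; rewrite ?iterSr //; split=> //; lia.
Qed.

(** Induction on the walk. A first step up is added to [i]; a first step down cancels a climbing
    step of the rest, or is added to [j] if there is none. *)
Lemma walk_ancestor x p : path fadj x p ->
  exists i j, (i + j <= size p)%N /\ iter i par x = iter j par (last x p).
Proof.
elim: p x => [|y p IH] x /=; first by exists 0%N, 0%N.
case/andP => /orP[] /eqP xy /IH [i [j [ij E]]].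
  by exists i.+1, j; split; rewrite ?iterSr ?xy //; lia.
case: i => [|i] in ij E *.
  by exists 0%N, j.+1; split; [lia | rewrite /= -E /=].
by exists i, j; rewrite -E iterSr xy; split=> //; lia.
Qed.

(** The subtree of [x] within [U]. The whole climb to [x] has to stay in [U], which keeps the set
    connected when [U] has holes. *)
Definition below (U : {set T}) (x : T) : {set T} :=
  [set y | `[< exists k, iter k par y = x /\ forall i, (i <= k)%N -> iter i par y \in U >]]%SET.

Lemma belowP (U : {set T}) x y : reflect (exists k, iter k par y = x /\
   forall i, (i <= k)%N -> iter i par y \in U) (y \in below U x).
Proof. by rewrite finset.inE; apply: asboolP. Qed.

Lemma below_sub U x : below U x \subset U.
Proof. by apply/fintype.subsetP => y /belowP[k [_ H]]; apply: (H 0%N). Qed.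

Lemma belowS (U U' : {set T}) x : U \subset U' -> below U x \subset below U' x.
Proof.
move=> /fintype.subsetP UU'; apply/fintype.subsetP => y /belowP[k [kx H]].
by apply/belowP; exists k; split=> // i /H /UU'.
Qed.

Lemma conn_below U x : conn e (below U x).
Proof.
apply: (@conn_center _ e esym _ x) => y /belowP[k [kx H]].
elim: k y kx H => [|k IH] y kx H.
  exists 0%N; rewrite -kx; apply: joined_refl; apply/belowP.
  by exists 0%N.
rewrite iterSr in kx.
have Hk i : (i <= k)%N -> iter i par (par y) \in U.
  by move=> ik; rewrite -iterSr; apply: H.
have [m ym] := IH _ kx Hk.
have yb : y \in below U x by apply/belowP; exists k.+1; rewrite iterSr.
have pyb : par y \in below U x by apply/belowP; exists k.
case: (par_edge y) => [E|E]; first by rewrite -{1}E; exists m.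
by exists (1 + m)%N; apply: joined_trans ym; apply: joined1.
Qed.

(* Outside the open ball of radius [r / 2] around [w]. *)
Definition off_ball (w x : T) : Prop := forall m, joined e predT m w x -> (r <= m.*2)%N.

Lemma not_off_ball w x : ~ off_ball w x -> exists2 m, joined e predT m w x & (m.*2 < r)%N.
Proof.
move=> /existsNP[m /not_implyP[wx mr]]; exists m => //.
by rewrite ltnNge; apply/negP.
Qed.

Section Region.
Variable U : {set T}.
Hypothesis U_off : forall x w, x \in U -> w \in Z -> off_ball w x.

Lemma regionNZ x : x \in U -> x \notin Z.
Proof.
move=> xU; apply/negP => xZ; have := U_off xU xZ (joined_refl e (erefl : predT x)).
by rewrite double0 leqNgt r_gt0.
Qed.

Lemma off_Z_path x p : all (fun z => z \notin Z) (x :: p) -> path e x p -> path fadj x p.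
Proof.
elim: p x => //= y p IH x /and3P[xZ yZ pZ] /andP[xy yp].
rewrite IH ?yZ // andbT /fadj.
by case: (edge_par xy) => [xz|yz|->|->]; rewrite ?eqxx ?orbT //;
   [move: xZ; rewrite xz | move: yZ; rewrite yz].
Qed.

(** If a walk of fewer than [r] hops visited some [w] in [Z], one of its ends would be at distance
    less than [r / 2] from [w]. Hence the walk avoids [Z] and uses forest edges only. *)
Lemma short_walk_forest x p : x \in U -> last x p \in U -> (size p < r)%N ->
  path e x p -> path fadj x p.
Proof.
move=> xU yU pr xp; apply: off_Z_path (xp).
apply/allP => w wp; apply/negP => wZ.
have [p1 [p2 [Ep wE]]] : exists p1 p2, p = p1 ++ p2 /\ w = last x p1.
  by case/splitPl: wp => p1 p2 <-; exists p1, p2.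
move: xp pr yU; rewrite Ep cat_path size_cat last_cat -wE => /andP[xp1 wp2] pr yU.
have j1 : joined e predT (size p1) x w by exists p1; split=> //; exact: all_predT.
have j2 : joined e predT (size p2) w (last w p2).
  by exists p2; split=> //; exact: all_predT.
have := U_off xU wZ (joined_sym esym j1); have := U_off yU wZ j2.
lia.
Qed.

(** Take [u] of least depth in [P] and trace a walk inside [P] back from [u]. Each step goes down to
    a child or back up along the climb to [u]; at [u] itself a step up is excluded by minimality,
    unless [u] is a root. *)
Lemma conn_top (P : {set T}) : P \subset U -> conn e P -> P != finset.set0 ->
  exists2 u, u \in P & P \subset below P u.
Proof.
move=> /fintype.subsetP PU cP /set0Pn[x0 x0P].
case: (@arg_minnP _ x0 (mem P) depth x0P) => u uP umin; exists u => //.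
apply/fintype.subsetP => y yP; have [m [p [yp pu _ Pp]]] := cP _ _ yP uP.
have {}yp : path fadj y p.
  by apply: off_Z_path yp; apply/allP => z /(allP Pp) /PU /regionNZ.
elim: p y yp pu Pp {yP} => [|y' p IH] y /=.
  by move=> _ -> _; apply/belowP; exists 0%N; split=> // i; rewrite leqn0 => /eqP->.
case/andP => yy' y'p pu /andP[yP Pp].
have /belowP[k [ku H]] := IH _ y'p pu Pp.
case/orP: yy' => /eqP E.
  apply/belowP; exists k.+1; rewrite iterSr E; split=> // -[|i] ik //.
  by rewrite iterSr E; apply: H.
case: k => [|k] in ku H *.
  move: ku => /= ku; move: E; rewrite ku => E; have := umin _ yP; rewrite -E.
  case: (depth_par u) => Eu; last by rewrite Eu ltnn.
  by move=> _; apply/belowP; exists 0%N; rewrite Eu; split=> // i; rewrite leqn0 => /eqP->.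
apply/belowP; exists k; rewrite -E -iterSr; split=> // i ik.
by rewrite -iterSr; apply: H.
Qed.

(* [i] and [j] are the numbers of steps from [x] and from a point of [P] up to a
   common ancestor; [j <= i] is what makes two such pieces close to each other. *)
Lemma close_ancestor x (P : {set T}) u :
  P \subset U -> u \in P -> P \subset below P u -> (depth u <= depth x)%N ->
  close_sets e r (below U x) P ->
  exists p i j, [/\ p \in P, iter i par x = iter j par p, (j <= i)%N & (i + j < r)%N].
Proof.
move=> /fintype.subsetP PU uP /fintype.subsetP Pu du [y [p [m [/belowP[k [kx Hk]] pP mr]]]].
move=> [q [yq qp qm _]].
have yU : y \in U by apply: (Hk 0%N).
have /walk_ancestor[i0 [j0 [ij0]]] : path fadj y q.
  by apply: short_walk_forest => //; [rewrite qp; apply: PU | apply: leq_ltn_trans mr].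
rewrite qp => E; have /belowP[l [lu Hl]] := Pu _ pP.
have xP_done : x \in P -> exists p i j,
    [/\ p \in P, iter i par x = iter j par p, (j <= i)%N & (i + j < r)%N].
  by move=> xP; exists x, 0%N, 0%N.
(* Either the climb from [y] to the common ancestor passes through [x], or it stops before [x], and
   then [x] is itself an ancestor of [p]. In both cases the ancestor found lies in [P] or is reached
   through the top [u], where [depth u <= depth x] bounds the climb from [u]. *)
have [ki|ik] := leqP k i0.
  have {}E : iter (i0 - k) par x = iter j0 par p by rewrite -E -kx -iterD subnK.
  have [lj|jl] := leqP l j0; last first.
    exists (iter j0 par p), (i0 - k)%N, 0%N; split=> //; last by lia.
    by apply: Hl; apply: ltnW.
  have /depth_ancestor[j jj [ju dju]] : iter (j0 - l) par u = iter (i0 - k) par x.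
    by rewrite E -lu -iterD subnK.
  exists u, (i0 - k)%N, j; split=> //; have := depth_iter (i0 - k) x; lia.
have xp : iter (k - i0 + j0) par p = x by rewrite iterD -E -iterD subnK // ltnW.
have [jl|lj] := leqP (k - i0 + j0) l; first by apply: xP_done; rewrite -xp; apply: Hl.
have /depth_ancestor[j jj [ju dju]] : iter (k - i0 + j0 - l) par u = x.
  by rewrite -lu -iterD subnK // ltnW.
by apply: xP_done; case: j ju dju {jj} => [<-//|j] _; lia.
Qed.

Lemma joined_ancestor (k : nat) x : joined e predT k x (iter k par x).
Proof.
elim: k => [|k IH]; first exact: joined_refl.
rewrite -addn1 addnC; have [E|E] := par_edge (iter k par x).
  by rewrite /= E; apply: joined_mono IH => //; lia.
by rewrite addnC; apply: joined_trans IH _; rewrite addn1 /=; apply: joined1.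
Qed.

(** From [p] climb [j] steps to the [i]-th ancestor of [x], then [i' - i] further steps to its
    [i']-th ancestor, and descend [j'] steps to [p']. As [j <= i], this takes at most [i' + j' < r]
    hops. *)
Lemma common_ancestor_close x (P P' : {set T}) p p' i j i' j' :
  p \in P -> p' \in P' -> iter i par x = iter j par p -> iter i' par x = iter j' par p' ->
  (j <= i)%N -> (i <= i')%N -> (i' + j' < r)%N -> close_sets e r P P'.
Proof.
move=> pP p'P E E' ji ii' r'; exists p, p', (j + (i' - i) + j')%N; split=> //; first lia.
apply: joined_trans (joined_sym esym (joined_ancestor j' p')).
have -> : iter j' par p' = iter (j + (i' - i)) par p.
  by rewrite addnC iterD -E -iterD subnK.
exact: joined_ancestor.
Qed.

Context {I : finType} (good : I -> {set T} -> Prop) (J : {set I}).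
Hypothesis good_mono : forall i (X Y : {set T}), conn e X -> conn e Y -> X \subset Y -> good i X -> good i Y.

(** Choose [x] of maximal depth such that some agent accepts its subtree. An acceptable [P] lies in
    the subtree of its top, which is then acceptable too, so the top is no deeper than [x]; two such
    sets close to the subtree of [x] are joined through ancestors of [x]. *)
Lemma forest_step :
  (exists i P, [/\ i \in J, conn e P, P \subset U & good i P]) ->
  exists i A, [/\ i \in J, conn e A, A \subset U, good i A &
    forall j P P', j \in J -> conn e P -> conn e P' -> P \subset U -> P' \subset U ->
      good j P -> good j P' -> close_sets e r A P -> close_sets e r A P' ->
      close_sets e r P P'].
Proof.
move=> [i0 [P0 [i0J cP0 P0U gP0]]].
(* An agent who accepts the empty set receives it, and nothing is close to it. Otherwise all
   acceptable sets are nonempty and have a top. *)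
have [[i [iJ gi0]]|no0] := pselect (exists i, i \in J /\ good i finset.set0).
  exists i, finset.set0; split=> //; [exact: conn0|exact: finset.sub0set|].
  by move=> j P P' _ _ _ _ _ _ _ [x [y [m []]]]; rewrite finset.inE.
have top j (P : {set T}) : j \in J -> conn e P -> P \subset U -> good j P ->
    exists u, [/\ u \in P, P \subset below P u & good j (below U u)].
  move=> jJ cP PU gP; have [|u uP Pu] := conn_top PU cP.
    by apply/eqP => P0E; apply: no0; exists j; rewrite -P0E.
  exists u; split=> //; apply: good_mono gP => //; first exact: conn_below.
  exact: fintype.subset_trans Pu (belowS _ PU).
have [u0 [_ _ g0]] := top _ _ i0J cP0 P0U gP0.
pose ok x := `[< exists i, i \in J /\ good i (below U x) >].
have ok0 : ok u0 by apply/asboolP; exists i0.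
case: (@arg_maxnP _ u0 ok depth ok0) => x /asboolP[i [iJ gi]] xmax.
exists i, (below U x); split=> //; [exact: conn_below|exact: below_sub|].
move=> j P P' jJ cP cP' PU P'U gP gP' clP clP'.
have [u [uP Pu gu]] := top _ _ jJ cP PU gP.
have [u' [u'P P'u gu']] := top _ _ jJ cP' P'U gP'.
have du : (depth u <= depth x)%N by apply: xmax; apply/asboolP; exists j.
have du' : (depth u' <= depth x)%N by apply: xmax; apply/asboolP; exists j.
have [p [a [b [pP E ba ab]]]] := close_ancestor PU uP Pu du clP.
have [p' [a' [b' [p'P E' ba' ab']]]] := close_ancestor P'U u'P P'u du' clP'.
have [aa'|a'a] := leqP a a'; first exact: (common_ancestor_close pP p'P E E').
apply: (close_sets_sym esym).
by apply: (common_ancestor_close p'P pP E' E) => //; exact: ltnW.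
Qed.

End Region.

(** * Induction on the agents and the feedback vertices *)

Section Greedy.
Context {I : finType} (good : I -> {set T} -> Prop) (N : nat) (P : I -> 'I_N -> {set T}).
Hypothesis good_mono : forall i (X Y : {set T}), conn e X -> conn e Y -> X \subset Y -> good i X -> good i Y.
Hypothesis Z_comp : forall w w', w \in Z -> w' \in Z -> connect e w w' -> w = w'.
Hypothesis P_conn : forall i k, conn e (P i k).
Hypothesis P_good : forall i k, good i (P i k).
Hypothesis P_sep : forall i k k', k != k' -> ~ close_sets e r (P i k) (P i k').

Let inside i (U : {set T}) := [set k | P i k \subset U]%SET.

(** Two lost parts would be close to each other, against [P_sep]. [Q] records the cause of the loss:
    meeting a ball, or being close to the set handed out. *)
Lemma lose_le1 i (U U' : {set T}) (Q : {set T} -> Prop) :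
  (forall k, P i k \subset U -> ~~ (P i k \subset U') -> Q (P i k)) ->
  (forall k k', P i k \subset U -> P i k' \subset U -> Q (P i k) -> Q (P i k') ->
     close_sets e r (P i k) (P i k')) ->
  (#|inside i U| <= #|inside i U'|.+1)%N.
Proof.
move=> lost two; rewrite -(cardsID (inside i U') (inside i U)) addnC.
apply: (@leq_add _ _ 1); last by apply: subset_leq_card; apply: finset.subsetIr.
rewrite leqNgt; apply/negP => /card_gt1P[k [k' [kD k'D kk']]].
move: kD k'D; rewrite !finset.inE => /andP[kU' kU] /andP[k'U' k'U].
by apply: (P_sep (negbT (negbTE kk'))); apply: two => //; apply: lost.
Qed.

Lemma close_balls w (X Y : {set T}) x y : x \in X -> y \in Y -> ~ off_ball w x -> ~ off_ball w y ->
  close_sets e r X Y.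
Proof.
move=> xX yY /not_off_ball[m wx mr] /not_off_ball[m' wy m'r].
exists x, y, (m + m')%N; split=> //; first by lia.
by apply: joined_trans wy; apply: joined_sym.
Qed.

(** [J] holds the agents still to be served, [U] the region left, and [Z'] the feedback vertices not
    yet treated; around all others the ball is already missing from [U]. Each step removes an agent
    or a feedback vertex, so [c] decreases. *)
Lemma greedy c : forall (J : {set I}) (U Z' : {set T}),
  (#|J| + #|Z'| <= c)%N -> Z' \subset Z ->
  (forall x w, x \in U -> w \in Z -> w \notin Z' -> off_ball w x) ->
  (forall j, j \in J -> (minn (#|J| + #|Z'|) (2 * #|J| - 1) <= #|inside j U|)%N) ->
  exists A : I -> {set T},
    (forall j, j \in J -> [/\ conn e (A j), A j \subset U & good j (A j)]) /\
    (forall j j', j \in J -> j' \in J -> j != j' -> ~ close_sets e r (A j) (A j')).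
Proof.
elim: c => [|c IH] J U Z' cJ Z'Z offU cnt.
  have J0 : J = finset.set0 by apply/eqP; rewrite -cards_eq0; lia.
  by exists (fun=> finset.set0); rewrite J0; split=> j; rewrite finset.inE.
have [J0|/set0Pn[j0 j0J]] := eqVneq J finset.set0.
  by exists (fun=> finset.set0); rewrite J0; split=> j; rewrite finset.inE.
(* All cases that serve an agent share this step: [A] goes to [i], and the induction hypothesis
   serves the others inside a region [U'] no point of which is close to [A]. *)
have give i (A U' Z'' : {set T}) : i \in J -> conn e A -> A \subset U -> good i A -> U' \subset U ->
    Z'' \subset Z' ->
    (forall x w, x \in U' -> w \in Z -> w \notin Z'' -> off_ball w x) ->
    (forall x, x \in U' -> ~ close_sets e r A [set x]%SET) ->
    (forall j, j \in J -> j != i ->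
       (minn (#|J|.-1 + #|Z''|) (2 * #|J|.-1 - 1) <= #|inside j U'|)%N) ->
    exists A : I -> {set T},
    (forall j, j \in J -> [/\ conn e (A j), A j \subset U & good j (A j)]) /\
    (forall j j', j \in J -> j' \in J -> j != j' -> ~ close_sets e r (A j) (A j')).
  move=> iJ cA AU gA U'U Z''Z' offU' farA cnt'.
  have cJi : #|J| = #|(J :\ i)%SET|.+1 by rewrite (cardsD1 i) iJ.
  have := subset_leq_card Z''Z' => cZ''.
  have [||||A' [A'1 A'2]] := IH (J :\ i)%SET U' Z''.
  - by move: cJ; rewrite cJi; lia.
  - exact: fintype.subset_trans Z''Z' Z'Z.
  - exact: offU'.
  - move=> j; rewrite !finset.inE => /andP[ji jJ]; have := cnt' _ jJ ji.
    by rewrite cJi.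
  have mem j : j \in J -> j != i -> j \in (J :\ i)%SET by rewrite !finset.inE => -> ->.
  have sepA j : j \in J -> j != i -> ~ close_sets e r A (A' j).
    move=> jJ ji [x [y [m [xA yA mr xy]]]].
    have [_ /fintype.subsetP A'U' _] := A'1 _ (mem _ jJ ji).
    by apply: (farA y (A'U' _ yA)); exists x, y, m; rewrite finset.inE.
  exists (fun j => if j == i then A else A' j); split=> [j jJ|j j' jJ j'J jj'].
    case: eqP => [->//|/eqP ji]; have [cA' A'U' gA'] := A'1 _ (mem _ jJ ji).
    by split=> //; exact: fintype.subset_trans U'U.
  case: eqP => [Ej|/eqP ji]; case: eqP => [Ej'|/eqP j'i].
  - by rewrite Ej Ej' eqxx in jj'.
  - exact: sepA.
  - by move/(close_sets_sym esym); apply: sepA.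
  - by apply: A'2 => //; apply: mem.
(* Without untreated feedback vertices, all of [U] is off the balls, so [forest_step] applies to it
   and each other agent loses at most one part. *)
have [Z'0|/set0Pn[w wZ']] := eqVneq Z' finset.set0.
  have offU' x w : x \in U -> w \in Z -> off_ball w x.
    by move=> xU wZ; apply: offU => //; rewrite Z'0 finset.inE.
  have [i [A [iJ cA AU gA two]]] : exists i A, [/\ i \in J, conn e A, A \subset U, good i A &
    forall j P P', j \in J -> conn e P -> conn e P' -> P \subset U -> P' \subset U ->
      good j P -> good j P' -> close_sets e r A P -> close_sets e r A P' ->
      close_sets e r P P'].
    apply: forest_step => //; have := cnt _ j0J.
    have : (0 < #|J|)%N by rewrite card_gt0; apply/set0Pn; exists j0.
    move=> J0 cn; have : (0 < #|inside j0 U|)%N by lia.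
    by rewrite card_gt0 => /set0Pn[k]; rewrite finset.inE => kU; exists j0, (P j0 k).
  pose U' := [set x in U | ~~ `[< close_sets e r A [set x]%SET >]]%SET.
  have U'U : U' \subset U by apply/fintype.subsetP => x; rewrite finset.inE => /andP[].
  apply: (give i A U' finset.set0) => //; first exact: finset.sub0set.
  - by move=> x w /(fintype.subsetP U'U) xU wZ _; apply: offU'.
  - by move=> x; rewrite finset.inE => /andP[_ /asboolPn].
  - move=> j jJ ji; have := cnt _ jJ; rewrite Z'0 cards0.
    move/minn_lose1; apply.
    apply: (@lose_le1 j U U' (fun X => close_sets e r A X)).
      move=> k kU /subsetPn[x xk]; rewrite finset.inE (fintype.subsetP kU _ xk) /= negbK.
      move=> /asboolP[a [y [m [aA]]]]; rewrite finset.inE => /eqP-> mr ax.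
      by exists a, x, m.
    by move=> k k' kU k'U c1 c2; apply: (two j).
have wZ := fintype.subsetP Z'Z _ wZ'.
(* [C] is the component of [w] and [B] the open ball around [w]. Inside [C] no other vertex of [Z]
   exists, so [C] without [B] is off all balls. *)
pose C := [set x | connect e w x]%SET.
pose B := [set x | ~~ `[< off_ball w x >]]%SET.
have inB x : x \in B -> ~ off_ball w x by rewrite finset.inE => /asboolPn.
have cZ1 : #|Z'| = #|(Z' :\ w)%SET|.+1 by rewrite (cardsD1 w) wZ'.
have Z1Z : (Z' :\ w)%SET \subset Z' by apply: finset.subD1set.
have offC x : x \in U -> x \notin C -> off_ball w x.
  by move=> xU; rewrite finset.inE => /negP xC m /joined_connect.
have off1 (U' : {set T}) : U' \subset U -> (forall x, x \in U' -> off_ball w x) ->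
    forall x w', x \in U' -> w' \in Z -> w' \notin (Z' :\ w)%SET -> off_ball w' x.
  move=> /fintype.subsetP U'U U'w x w' xU' w'Z; rewrite !finset.inE negb_and negbK.
  by case/orP => [/eqP->|w'Z']; [apply: U'w | apply: offU => //; apply: U'U].
pose U1 := ((U :&: C) :\: B)%SET.
have U1U : U1 \subset U.
  by apply/fintype.subsetP => x; rewrite !finset.inE => /and3P[].
have U1off x w' : x \in U1 -> w' \in Z -> off_ball w' x.
  rewrite !finset.inE negbK => /and3P[/asboolP wx xU wxC] w'Z.
  have [->//|w'w] := eqVneq w' w; move=> m /joined_connect w'x.
  case/eqP: w'w; apply: Z_comp => //; apply: connect_trans w'x _.
  by rewrite (sym_connect_sym esym).
have sub_C (X : {set T}) x : conn e X -> x \in X -> x \in C -> X \subset C.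
  move=> cX xX; rewrite finset.inE => wx; apply/fintype.subsetP => y yX.
  by rewrite finset.inE; apply: conn_sub_component cX xX wx _ yX.
(* First case: someone accepts a set in the component off the ball. Then each other agent loses at
   most one part that meets the ball and one that is close to [A]. *)
have [ex1|no1] := pselect (exists i Q, [/\ i \in J, conn e Q, Q \subset U1 & good i Q]).
  have [i [A [iJ cA AU1 gA two]]] := forest_step U1off good_mono ex1.
  pose U2 := (U :\: B)%SET.
  pose U' := [set x in U2 | ~~ `[< close_sets e r A [set x]%SET >]]%SET.
  have U'U2 : U' \subset U2 by apply/fintype.subsetP => x; rewrite finset.inE => /andP[].
  have U2U : U2 \subset U by apply: finset.subsetDl.
  have U'U := fintype.subset_trans U'U2 U2U.
  apply: (give i A U' (Z' :\ w)%SET) => //; first exact: fintype.subset_trans U1U.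
  - apply: off1 => // x /(fintype.subsetP U'U2); rewrite !finset.inE negbK.
    by case/andP => /asboolP.
  - by move=> x; rewrite finset.inE => /andP[_ /asboolPn].
  - move=> j jJ ji; have := cnt _ jJ; rewrite cZ1.
    move/minn_lose2; apply.
    apply: (@leq_trans #|inside j U2|.+1).
      apply: (@lose_le1 j U U2 (fun X => exists2 x, x \in X & x \in B)).
        move=> k kU /subsetPn[x xk]; rewrite finset.inE (fintype.subsetP kU _ xk) andbT negbK.
        by exists x.
      by move=> k k' _ _ [x xk /inB xB] [y yk' /inB yB]; exact: (close_balls xk yk' xB yB).
    rewrite ltnS; apply: (@lose_le1 j U2 U' (fun X => close_sets e r A X)).
      move=> k kU /subsetPn[x xk]; rewrite finset.inE (fintype.subsetP kU _ xk) /= negbK.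
      move=> /asboolP[a [y [m [aA]]]]; rewrite finset.inE => /eqP-> mr ax.
      by exists a, x, m.
    (* A part close to [A] is connected and reaches the component of [w], hence lies inside it; this
       puts it in [U1], where [two] applies. *)
    move=> k k' kU k'U c1 c2.
    have inU1 l : P j l \subset U2 -> close_sets e r A (P j l) -> P j l \subset U1.
      move=> lU2 [a [x [m [aA xl _ /joined_connect ax]]]].
      have : P j l \subset C.
        apply: (sub_C _ x) => //; rewrite finset.inE; apply: connect_trans ax.
        have := fintype.subsetP AU1 _ aA; by rewrite !finset.inE => /and3P[].
      move=> lC; apply/fintype.subsetP => z zl; have := fintype.subsetP lU2 _ zl.
      by rewrite !(finset.in_setD, finset.in_setI) (fintype.subsetP lC _ zl) andbT.
    by apply: (two j) => //; apply: inU1.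
pose U' := (U :\: C)%SET.
have U'U : U' \subset U by apply: finset.subsetDl.
have U'off x w' : x \in U' -> w' \in Z -> w' \notin (Z' :\ w)%SET -> off_ball w' x.
  by apply: off1 => // y; rewrite finset.in_setD => /andP[yC yU]; apply: offC.
have lostC j k : P j k \subset U -> ~~ (P j k \subset U') ->
    exists2 x, x \in P j k & x \in C.
  move=> kU /subsetPn[x xk]; rewrite finset.inE (fintype.subsetP kU _ xk) andbT negbK.
  by exists x.
(* Nobody accepts a set in [U1], so every part inside the component meets the ball, and each agent
   has at most one there. If someone accepts a set in the component, the whole component is spent on
   that agent. *)
have [[i [A [iJ cA AUC gA]]]|no2] :=
  pselect (exists i Q, [/\ i \in J, conn e Q, Q \subset (U :&: C)%SET & good i Q]).
  have [AU AC] : A \subset U /\ A \subset C by apply/andP; rewrite -finset.subsetI.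
  apply: (give i A U' (Z' :\ w)%SET) => //.
  - move=> x; rewrite finset.in_setD => /andP[xC xU] [a [y [m [aA]]]].
    rewrite finset.inE => /eqP-> _ /joined_connect ax; move: xC; rewrite finset.inE.
    have := fintype.subsetP AC _ aA; rewrite finset.inE => wa.
    by rewrite (connect_trans wa ax).
  - move=> j jJ ji; have := cnt _ jJ; rewrite cZ1.
    move=> cn; apply: (@minn_lose1 _ _ #|inside j U|).
      by apply: leq_trans cn; apply: minn_mono2; rewrite addnS.
    apply: (@lose_le1 j U U' (fun X => exists2 x, x \in X & x \in B)).
      move=> k kU /lostC[//|x xk xC].
      have kC : P j k \subset C by apply: (sub_C _ x).
      have [kB|] := boolP (P j k \subset (~: B)%SET); last first.
        by case/subsetPn => y yk; rewrite finset.in_setC negbK; exists y.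
      case: no1; exists j, (P j k); split=> //.
      apply/fintype.subsetP => y yk; have := fintype.subsetP kB _ yk.
      by rewrite !(finset.in_setD, finset.in_setI, finset.in_setC)
          (fintype.subsetP kC _ yk) (fintype.subsetP kU _ yk) !andbT.
    by move=> k k' _ _ [x xk /inB xB] [y yk' /inB yB]; exact: (close_balls xk yk' xB yB).
(* Nobody accepts anything in the component, so it contains no part at all and is discarded without
   loss. *)
have [||||A [A1 A2]] := IH J U' (Z' :\ w)%SET.
- by move: cJ; rewrite cZ1; lia.
- exact: fintype.subset_trans Z1Z Z'Z.
- exact: U'off.
- move=> j jJ; have := cnt _ jJ; rewrite cZ1.
  move=> cn; suff : inside j U \subset inside j U'.
    move/subset_leq_card; apply: leq_trans; apply: leq_trans cn.
    by apply: minn_mono2; rewrite addnS.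
  apply/fintype.subsetP => k; rewrite !finset.inE => kU.
  apply/negPn/negP => /(lostC _ _ kU)[x xk xC]; apply: no2; exists j, (P j k); split=> //.
  by rewrite finset.subsetI kU (sub_C _ x).
exists A; split=> // j jJ; have [cA AU gA] := A1 _ jJ; split=> //.
exact: fintype.subset_trans U'U.
Qed.

Lemma discrete_allocation : (minn (#|I| + #|Z|) (2 * #|I| - 1) <= N)%N ->
  exists A : I -> {set T},
    (forall j, conn e (A j) /\ good j (A j)) /\
    (forall j j', j != j' -> ~ close_sets e r (A j) (A j')).
Proof.
move=> cN; have [||||A [A1 A2]] := @greedy (#|I| + #|Z|) finset.setT finset.setT Z.
- by rewrite cardsT.
- exact: subxx.
- by move=> x w _ -> .
- move=> j _; rewrite cardsT; have -> : inside j finset.setT = finset.setT.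
    by apply/setP => k; rewrite !finset.inE finset.subsetT.
  by rewrite cardsT card_ord.
exists A; split=> [j|j j' jj']; last by apply: A2; rewrite ?finset.inE.
by have [] := A1 j (finset.in_setT _).
Qed.

End Greedy.
End Forest.

(** * Acyclic graphs and feedback vertices *)

(** The depth is the number of steps to the root. It is computed by [dp] with fuel [n], and by
    [stable] any fuel of at least the rank gives the same value. *)
Lemma depth_of_rank (T : eqType) (par : T -> T) (rank : T -> nat) :
  (forall x, par x = x \/ (rank (par x) < rank x)%N) ->
  exists depth : T -> nat, forall x, par x = x \/ depth x = (depth (par x)).+1.
Proof.
move=> rk; pose fix dp n x {struct n} := if n is n'.+1 then
  if par x == x then 0%N else (dp n' (par x)).+1 else 0%N.
have stable n n' x : (rank x <= n)%N -> (rank x <= n')%N -> dp n x = dp n' x.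
  elim: n n' x => [|n IH] [|n'] x //=.
  - by case: eqP => // ne; case: (rk x) => // ? ?; lia.
  - by case: eqP => // ne; case: (rk x) => // ? ?; lia.
  - by case: eqP => // ne; case: (rk x) => // ? ? ?; rewrite (IH n') //; lia.
exists (fun x => dp (rank x) x) => x; case: (rk x) => [|lt]; first by left.
have [|/eqP ne] := eqVneq (par x) x; first by left.
right; case E : (rank x) => [|n] /=; first by rewrite E in lt.
by case: eqP => // _; congr _.+1; apply: stable => //; lia.
Qed.

Section Graph.
Context {V E : finType} (ends : E -> V * V).

Definition incident (e : E) (v : V) : bool := ((ends e).1 == v) || ((ends e).2 == v).

(** Cycles are closed trails without repeated edges, so loops and pairs of parallel edges count. *)
Definition acyclic_edges (F : {set E}) : Prop :=
  forall a s, s != [::] -> uniq s -> is_walk ends a a s -> ~ {subset s <= F}.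

Lemma is_walk_cat a b s1 s2 : is_walk ends a b (s1 ++ s2) <->
  exists x, is_walk ends a x s1 /\ is_walk ends x b s2.
Proof.
elim: s1 a => [|e s1 IH] a /=.
  by split=> [wk|[x [-> //]]]; exists a.
split=> [[x [ex /IH[y [xy yb]]]]|[y [[x [ex xy]] yb]]].
  by exists y; split=> //; exists x.
by exists x; split=> //; apply/IH; exists y.
Qed.

(* A maximal trail ends at a leaf. *)
Lemma acyclic_leaf (F : {set E}) : acyclic_edges F -> F != finset.set0 ->
  exists e v, [/\ e \in F, incident e v, (ends e).1 != (ends e).2 &
    forall e', e' \in F -> incident e' v -> e' = e].
Proof.
move=> acF /set0Pn[e0 e0F].
have noloop e : e \in F -> (ends e).1 != (ends e).2.
  move=> eF; apply/eqP => E12; apply: (acF (ends e).1 [:: e]) => //.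
    by exists (ends e).1; split=> //; left; rewrite {2}E12; case: (ends e).
  by move=> x; rewrite inE => /eqP->.
pose tr n := `[< exists a b s, [/\ uniq s, {subset s <= F}, is_walk ends a b s & size s = n] >].
have tr1 : exists n, tr n.
  exists 1%N; apply/asboolP; exists (ends e0).1, (ends e0).2, [:: e0]; split=> //.
    by move=> x; rewrite inE => /eqP->.
  by exists (ends e0).2; split=> //; left; case: (ends e0).
have trb n : tr n -> (n <= #|E|)%N.
  by case/asboolP => a [b [s [us _ _ <-]]]; rewrite -(card_uniqP us) max_card.
case: (ex_maxnP tr1 trb) => n /asboolP[a [b [s [us sF wk sn]]]] nmax.
have n1 : (1 <= n)%N.
  apply: nmax; apply/asboolP; exists (ends e0).1, (ends e0).2, [:: e0]; split=> //.
    by move=> x; rewrite inE => /eqP->.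
  by exists (ends e0).2; split=> //; left; case: (ends e0).
case/lastP: s us sF wk sn => [|s e] us sF wk sn; first by rewrite -sn in n1.
have eF : e \in F by apply: sF; rewrite mem_rcons inE eqxx.
exists e, b; split=> //; last first.
  move=> e' e'F e'b; apply/eqP; apply/negPn/negP => e'e.
  (* An edge at the end [b] that is not in the trail would extend it. One that is in the trail,
     other than the last, closes a cycle with the edges after it, itself included or not according
     to which of its ends is [b]. *)
  have [e's|e's] := boolP (e' \in rcons s e); last first.
    suff : tr n.+1 by move/nmax; rewrite ltnn.
    have [c ec] : exists c, ends e' = (b, c) \/ ends e' = (c, b).
      case/orP: e'b => /eqP Eb; [exists (ends e').2; left|exists (ends e').1; right];
      by rewrite -Eb; case: (ends e').
    apply/asboolP; exists a, c, (rcons (rcons s e) e'); split.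
    - by rewrite rcons_uniq e's us.
    - by move=> x; rewrite mem_rcons inE => /orP[/eqP->//|/sF].
    - rewrite -cats1; apply/is_walk_cat; exists b; split=> //.
      by exists c.
    - by rewrite size_rcons sn.
  case/splitPr Es : _ / e's wk us sF => [s1 s2] wk us sF.
  have us2 : uniq (e' :: s2) by move: us; rewrite cat_uniq => /and3P[].
  have s2F : {subset e' :: s2 <= F}.
    by move=> x xs; apply: sF; rewrite mem_cat xs orbT.
  move/is_walk_cat: wk => [p [_ [q [pq qb]]]].
  have [bp|bq] : b = p \/ b = q.
    by case: pq e'b => E'; rewrite /incident E' /= => /orP[] /eqP->; auto.
    apply: (acF b (e' :: s2)) => //; exists q; rewrite bp; split=> //.
    by rewrite -bp.
  apply: (acF b s2) => //.
  - case: s2 {us us2 s2F qb sF} Es => // Es; exfalso; case/eqP: e'e.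
    by have := congr1 (last e) Es; rewrite last_rcons last_cat.
  - by case/andP: us2.
  - by rewrite {1}bq.
  - by move=> x xs; apply: s2F; rewrite inE xs orbT.
  by apply: noloop.
move: wk; rewrite -cats1 => /is_walk_cat[x [_ /= [y [xy <-]]]].
by case: xy => Ee; rewrite /incident Ee eqxx ?orbT.
Qed.

Definition child (dir : E -> bool) (e : E) : V := if dir e then (ends e).1 else (ends e).2.
Definition parent (dir : E -> bool) (e : E) : V := if dir e then (ends e).2 else (ends e).1.

(** Induction on the edges: remove a leaf edge [e], make its leaf [v] the child, and rank [v] just
    above the other end. No other edge of [F] touches [v], so the orientation of the rest is
    undisturbed. *)
Lemma acyclic_orientation (F : {set E}) : acyclic_edges F ->
  exists (dir : E -> bool) (d : V -> nat),
    (forall e, e \in F -> (d (parent dir e) < d (child dir e))%N) /\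
    (forall e e', e \in F -> e' \in F -> child dir e = child dir e' -> e = e').
Proof.
move En : #|F| => n; elim: n F En => [|n IH] F Fn acF.
  have F0 : F = finset.set0 by apply/eqP; rewrite -cards_eq0 Fn.
  by exists xpredT, (fun=> 0%N); rewrite F0; split=> e; rewrite finset.inE.
have [|e [v [eF ev loop leaf]]] := acyclic_leaf acF.
  by rewrite -cards_eq0 Fn.
have [|a s s0 us wk sF|dir [d [d1 d2]]] := IH (F :\ e)%SET.
- by have := cardsD1 e F; rewrite eF Fn => -[].
- by apply: (acF a s) => // x /sF; rewrite finset.inE => /andP[].
pose dir' e0 := if e0 == e then (ends e).1 == v else dir e0.
have ce : child dir' e = v.
  rewrite /child /dir' eqxx; case: eqP => // ne; move: ev; rewrite /incident.
  by case/orP => /eqP.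
have pe : parent dir' e != v.
  rewrite /parent /dir' eqxx; case: ((ends e).1 =P v) => [<-|/eqP//]; by rewrite eq_sym.
pose d' u := if u == v then (d (parent dir' e)).+1 else d u.
have other e' : e' \in F -> e' != e ->
    [/\ e' \in (F :\ e)%SET, child dir' e' = child dir e', parent dir' e' = parent dir e',
        child dir e' != v & parent dir e' != v].
  move=> e'F e'e; rewrite !finset.inE e'e e'F; split=> //.
  - by rewrite /child /dir' (negbTE e'e).
  - by rewrite /parent /dir' (negbTE e'e).
  - apply/eqP => Ec; case/eqP: e'e; apply: leaf => //; rewrite /incident -Ec /child.
    by case: (dir e'); rewrite eqxx ?orbT.
  - apply/eqP => Ec; case/eqP: e'e; apply: leaf => //; rewrite /incident -Ec /parent.
    by case: (dir e'); rewrite eqxx ?orbT.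
exists dir', d'; split=> [e' e'F|e1 e2 e1F e2F].
  have [->|e'e] := eqVneq e' e; first by rewrite ce /d' eqxx (negbTE pe).
  have [e'F' -> -> c p] := other _ e'F e'e.
  by rewrite /d' (negbTE c) (negbTE p); apply: d1.
have [->|n1] := eqVneq e1 e; have [->|n2] := eqVneq e2 e => //.
- by have [_ -> _ /eqP c _] := other _ e2F n2; rewrite ce => E2; case: c.
- by have [_ -> _ /eqP c _] := other _ e1F n1; rewrite ce => E2; case: c.
have [f1 -> _ _ _] := other _ e1F n1; have [f2 -> _ _ _] := other _ e2F n2.
exact: d2.
Qed.

Lemma adj_sym : symmetric (adj ends).
Proof.
by move=> a b; apply/existsP/existsP => -[e]; rewrite orbC => H; exists e.
Qed.

Lemma adj_ends e : adj ends (ends e).1 (ends e).2.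
Proof. by apply/existsP; exists e; case: (ends e) => a b /=; rewrite eqxx. Qed.

Lemma component_connect a b : connect (adj ends) a b -> component ends a = component ends b.
Proof.
move=> ab; apply/setP => x; rewrite !finset.inE.
exact: (same_connect (sym_connect_sym adj_sym) ab).
Qed.

Lemma walk_connect a b s : is_walk ends a b s ->
  forall e, e \in s -> connect (adj ends) a (ends e).1 /\ connect (adj ends) a (ends e).2.
Proof.
elim: s a => // e s IH a /= [x [ex xb]] e'.
have ax : adj ends a x.
  by apply/existsP; exists e; case: ex => ->; rewrite eqxx ?orbT.
rewrite inE => /orP[/eqP->|/(IH _ xb)[c1 c2]].
  by case: ex => -> /=; split=> //; apply: connect1.
by split; [apply: connect_trans c1 | apply: connect_trans c2]; apply: connect1.
Qed.

Lemma fvs_num_attained (W : {set V}) : exists S : {set V},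
  [/\ S \subset W, ~ has_cycle_in ends (W :\: S)%SET & #|S| = fvs_num ends W].
Proof.
rewrite /fvs_num; pose K n := exists S : {set V},
  [/\ S \subset W, ~ has_cycle_in ends (W :\: S)%SET & #|S| = n].
apply: (big_ind K).
(* The default value [#|W|] of the minimum is attained by removing all of [W]. *)
- exists W; split=> // -[a [[|e s] [//= _ [_ [_ H]]]]].
  by have := H e (mem_head _ _); rewrite finset.setDv !finset.inE.
- by move=> m n Km Kn; rewrite /minn; case: ifP.
- by move=> S /andP[SW /asboolP nc]; exists S.
Qed.

(** [Z] takes one vertex from each component that has a cycle, the choice depending only on the
    component. Any feedback set [S] of the whole graph meets each of these components, and picking a
    point of [S] in each is injective, which bounds the size of [Z]. *)
Lemma fvs_transversal : (forall a, (fvs_num ends (component ends a) <= 1)%N) ->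
  exists Z : {set V}, [/\ (#|Z| <= fvs_num ends [set: V]%SET)%N,
    ~ has_cycle_in ends (~: Z)%SET &
    forall w w', w \in Z -> w' \in Z -> connect (adj ends) w w' -> w = w'].
Proof.
move=> fvs1.
pose ok (a w : V) := (w \in component ends a) &&
  `[< ~ has_cycle_in ends (component ends a :\ w)%SET >].
pose g a := if `[< has_cycle_in ends (component ends a) >] then [pick w | ok a w] else None.
have gE a b : connect (adj ends) a b -> g a = g b.
  by move=> /component_connect Eab; rewrite /g /ok Eab.
pose Z := [set w | g w == Some w]%SET; exists Z; split.
- have [S [_ ncS <-]] := fvs_num_attained [set: V]%SET.
  have meet w : w \in Z -> exists x, (x \in S) && (x \in component ends w).
    rewrite finset.inE /g; case: asboolP => // -[a [s [s0 [us [wk sW]]]]] _.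
    case: (pselect (exists x, (x \in S) && (x \in component ends w))) => // no.
    case: ncS; exists a, s; split=> //; split=> //; split=> // e /sW /andP[e1 e2].
    rewrite !finset.inE !andbT; apply/andP; split; apply/negP => eS; apply: no.
      by exists (ends e).1; rewrite eS.
    by exists (ends e).2; rewrite eS.
  pose f w := if pselect (exists x, (x \in S) && (x \in component ends w)) is left ex
              then xchoose ex else w.
  have fP w : w \in Z -> (f w \in S) && (f w \in component ends w).
    move=> /meet ex; rewrite /f; case: pselect => // ex'.
    exact: (xchooseP ex').
  have Zuniq w w' : w \in Z -> w' \in Z -> connect (adj ends) w w' -> w = w'.
    by rewrite !finset.inE => /eqP gw /eqP gw' /gE; rewrite gw gw' => -[].
  rewrite -(@card_in_imset _ _ f).
    apply: subset_leq_card; apply/fintype.subsetP => y /imsetP[w /fP/andP[fS _] ->] //.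
  move=> w w' wZ w'Z Ef; apply: Zuniq => //.
  have /andP[_] := fP _ wZ; have /andP[_] := fP _ w'Z; rewrite Ef !finset.inE => c1 c2.
  by apply: connect_trans c2 _; rewrite (sym_connect_sym adj_sym).
- case=> a [s [s0 [us [wk sZ]]]].
  have cyc : has_cycle_in ends (component ends a).
    exists a, s; do 3!split=> //.
    move=> e /(walk_connect wk)[c1 c2]; by rewrite !finset.inE c1 c2.
  have [S [SC ncS S1]] := fvs_num_attained (component ends a).
  have : (#|S| <= 1)%N by rewrite S1.
  rewrite leq_eqVlt ltnS leqn0 => /orP[/cards1P[w Sw]|]; last first.
    by rewrite cards_eq0 => /eqP S0; apply: ncS; rewrite S0 finset.setD0.
  have okw : ok a w.
    rewrite /ok -Sw; apply/andP; split; last by apply/asboolP.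
    by rewrite (fintype.subsetP SC) // Sw finset.inE.
  have [x ga] : exists x, g a = Some x.
    rewrite /g; case: asboolP => // _; case: pickP => [x|/(_ w)]; first by exists x.
    by rewrite okw.
  have /andP[xa /asboolP ncx] : ok a x.
    move: ga; rewrite /g; case: asboolP => // _; case: pickP => // y oky [<-] //.
  have xZ : x \in Z.
    by rewrite finset.inE -(gE a x) ?ga //; move: xa; rewrite finset.inE.
  apply: ncx; exists a, s; do 3!split=> //.
  move=> e es; have [c1 c2] := walk_connect wk es.
  rewrite !finset.inE c1 c2 !andbT; have := sZ _ es; rewrite !finset.in_setC.
  by case/andP => z1 z2; apply/andP; split; apply/eqP => Ex;
     [rewrite Ex xZ in z1|rewrite Ex xZ in z2].
- by move=> w w'; rewrite !finset.inE => /eqP gw /eqP gw' /gE; rewrite gw gw' => -[].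
Qed.

Lemma acyclic_edges_off (Z : {set V}) : ~ has_cycle_in ends (~: Z)%SET ->
  acyclic_edges [set e | ((ends e).1 \notin Z) && ((ends e).2 \notin Z)]%SET.
Proof.
move=> nc a s s0 us wk sF; apply: nc; exists a, s; do 3!split=> //.
by move=> e /sF; rewrite !finset.inE.
Qed.

(* An edge meeting [Z] is oriented so that its child end lies in [Z], which frees it
   from both constraints. *)
Lemma orientation_off (Z : {set V}) : ~ has_cycle_in ends (~: Z)%SET ->
  exists (dir : E -> bool) (d : V -> nat),
    (forall e, child dir e \notin Z -> (d (parent dir e) < d (child dir e))%N) /\
    (forall e e', child dir e \notin Z -> child dir e = child dir e' -> e = e').
Proof.
move=> /acyclic_edges_off/acyclic_orientation [dir [d [d1 d2]]].
pose dir' e := if (ends e).1 \in Z then true else if (ends e).2 \in Z then false else dir e.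
have dir'P e : child dir' e \notin Z -> [/\ child dir' e = child dir e, parent dir' e = parent dir e &
    e \in [set e | ((ends e).1 \notin Z) && ((ends e).2 \notin Z)]%SET].
  rewrite /child /parent finset.inE /dir'; case e1: ((ends e).1 \in Z); first by rewrite e1.
  by case e2: ((ends e).2 \in Z); first by rewrite e2.
exists dir', d; split=> [e cZ|e e' cZ cE].
  by have [-> -> eF] := dir'P _ cZ; apply: d1.
have c'Z : child dir' e' \notin Z by rewrite -cE.
have [E1 _ eF] := dir'P _ cZ; have [E2 _ e'F] := dir'P _ c'Z.
by apply: d2 => //; rewrite -E1 -E2.
Qed.

End Graph.

Local Open Scope classical_set_scope.
Local Open Scope ring_scope.

(** * Points at distance less than the edge lengths *)

Section Metric.
Context {R : realType} {V E : finType} (ends : E -> V * V) (len : E -> R) (s : R).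
Hypothesis s_gt0 : 0 < s.
Hypothesis s_len : forall e, s <= len e.
Local Notation point := (cake_pt R V E).
Local Notation pt := (@pt_at R V E ends len).
Local Notation rep := (@rep R V E ends len).
Local Notation leg := (@leg R V E ends len).

Lemma len_gt0 e : 0 < len e. Proof. exact: lt_le_trans (s_len e). Qed.

Lemma pt0 e : pt e 0 = PV (ends e).1. Proof. by rewrite /pt_at lexx. Qed.

Lemma ptlen e : pt e (len e) = PV (ends e).2.
Proof. by rewrite /pt_at lexx leNgt len_gt0. Qed.

Lemma pt_mid e t : 0 < t < len e -> pt e t = PE e t.
Proof. by case/andP => t0 tl; rewrite /pt_at leNgt t0 leNgt tl. Qed.

Lemma pt_cases e t : 0 <= t <= len e ->
  [\/ t = 0, t = len e | 0 < t < len e].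
Proof.
case/andP; rewrite !le_eqVlt => /orP[/eqP<-|t0]; first by constructor 1.
by case/orP => [/eqP->|tl]; [constructor 2 | constructor 3; rewrite t0].
Qed.

Lemma rep_PV v e t : rep (PV v) e t ->
  (t = 0 /\ (ends e).1 = v) \/ (t = len e /\ (ends e).2 = v).
Proof.
case=> /pt_cases[->|->|tm]; first by rewrite pt0 => -[]; left.
  by rewrite ptlen => -[]; right.
by rewrite pt_mid.
Qed.

Lemma rep_PE e0 t0 e t : rep (PE e0 t0) e t -> [/\ e = e0, t = t0 & 0 < t < len e].
Proof.
case=> /pt_cases[->|->|tm]; first by rewrite pt0.
  by rewrite ptlen.
by rewrite pt_mid // => -[<- <-].
Qed.

Lemma rep_dich x e t : rep x e t ->
  (exists2 v, x = PV v & (t = 0 /\ (ends e).1 = v) \/ (t = len e /\ (ends e).2 = v)) \/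
  x = PE e t.
Proof.
case: x => [v|e0 t0] xr; first by left; exists v => //; apply: rep_PV.
by right; have [-> -> _] := rep_PE xr.
Qed.

Lemma leg_ge0 x a d : leg x a d -> 0 <= d.
Proof.
case=> [[_ ->]//|[e [t [[/andP[t0 tl] _] []]]]] [_ ->] //.
by rewrite subr_ge0.
Qed.

Lemma leg_PV v a d : leg (PV v) a d -> (d = 0 /\ v = a) \/ s <= d.
Proof.
case=> [[[->] ->]|[e [t [/rep_PV xr]]]]; first by left.
by case: xr => -[-> <-] [] [<- ->]; rewrite ?subrr ?subr0; (try by left); right; exact: s_len.
Qed.

(* For [z < s] this is [Dist x y <= z]: as edges have length at least [s], a path
   shorter than [s] contains no whole edge, so it passes through at most one vertex. *)
Definition dist_le (z : R) (x y : point) : Prop :=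
  (exists e t t', [/\ rep x e t, rep y e t' & `|t - t'| <= z]) \/
  (exists a d1 d2, [/\ leg x a d1, leg y a d2 & d1 + d2 <= z]).

Lemma dist_le_sym z x y : dist_le z x y -> dist_le z y x.
Proof.
case=> [[e [t [t' [? ? ?]]]]|[a [d1 [d2 [? ? ?]]]]]; [left|right].
  by exists e, t', t; rewrite distrC.
by exists a, d2, d1; rewrite addrC.
Qed.

Lemma dist_le_mono z z' x y : z <= z' -> dist_le z x y -> dist_le z' x y.
Proof.
move=> zz' [[e [t [t' [? ? ?]]]]|[a [d1 [d2 [? ? ?]]]]]; [left|right].
  by exists e, t, t'; split=> //; exact: le_trans zz'.
by exists a, d1, d2; split=> //; exact: le_trans zz'.
Qed.

Lemma dist_le_Dist z x y : dist_le z x y -> (Dist ends len x y <= z%:E)%E.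
Proof.
case=> [[e [t [t' [xr yr tz]]]]|[a [d1 [d2 [xl yl dz]]]]].
  apply: (@le_trans _ _ (`|t - t'|)%:E); last by rewrite lee_fin.
  by apply: ereal_inf_lbound; left; exists e, t, t'.
apply: (@le_trans _ _ (d1%:E + distV ends len a a + d2%:E)%E).
  by apply: ereal_inf_lbound; right; exists a, a, d1, d2.
apply: (@le_trans _ _ (d1%:E + 0%:E + d2%:E)%E); last by rewrite -!EFinD lee_fin addr0.
apply: leeD => //; apply: leeD => //; apply: ereal_inf_lbound.
by exists [::] => //; rewrite big_nil.
Qed.

Lemma walk_short a b p : is_walk ends a b p -> \sum_(e <- p) len e < s -> a = b.
Proof.
case: p => [//|e p] _; rewrite big_cons => H; exfalso.
have : 0 <= \sum_(e <- p) len e by apply: sumr_ge0 => i _; exact: ltW (len_gt0 i).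
have := s_len e; lra.
Qed.

Lemma Dist_dist_le z x y : (Dist ends len x y < z%:E)%E -> z <= s ->
  exists2 z', z' < z & dist_le z' x y.
Proof.
move=> /ereal_inf_lt[_ [[e [t [t' [xr [yr ->]]]]]|[a [b [d1 [d2 [xl [yl ->]]]]]]]].
  by rewrite lte_fin => tz zs; exists (`|t - t'|) => //; left; exists e, t, t'.
move=> dz zs; have d10 := leg_ge0 xl; have d20 := leg_ge0 yl.
have dV0 : (0 <= distV ends len a b)%E.
  apply/ereal_infP => _ [p _ <-]; rewrite lee_fin; apply: sumr_ge0 => e _.
  exact: ltW (len_gt0 e).
have ab : a = b.
  have : (distV ends len a b < s%:E)%E.
    apply: (@le_lt_trans _ _ (d1%:E + distV ends len a b + d2%:E)%E).
      apply: (@le_trans _ _ (d1%:E + distV ends len a b)%E); last by rewrite leeDl.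
      by rewrite leeDr.
    by apply: (lt_le_trans dz); rewrite lee_fin.
  by case/ereal_inf_lt => _ [p wp <-]; rewrite lte_fin; exact: walk_short.
exists (d1 + d2); last by right; exists a, d1, d2; split=> //; rewrite ab.
rewrite -lte_fin EFinD; apply: le_lt_trans dz; apply: leeD => //.
by rewrite leeDl.
Qed.

(** Moving one end of a short path along an edge. If [y] is a vertex, the new path passes through
    it, because a nontrivial leg ending at [y] would already have length at least [s]; if [y] is an
    interior point, the old path already ends on [e]. *)
Lemma dist_le_step z x y y' e t t' : dist_le z x y -> rep y e t -> rep y' e t' ->
  z + `|t - t'| < s -> dist_le (z + `|t - t'|) x y'.
Proof.
move=> W yr y'r zs.
have vleg v : y = PV v -> leg y' v `|t - t'|.
  move=> yv; move: yr; rewrite yv => /rep_PV yr'.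
  have [/andP[t'0 t'l] _] := y'r.
  right; exists e, t'; split=> //; case: yr' => -[-> Ev]; [left|right]; split=> //.
    by rewrite sub0r normrN ger0_norm.
  by rewrite ger0_norm // subr_ge0.
have [[v yv yvr]|yE] := rep_dich yr.
- case: W => [[e1 [u [u1 [xr yr1 uz]]]]|[a [d1 [d2 [xl yl dz]]]]].
    right; exists v, `|u - u1|, `|t - t'|; split; [|exact: vleg|by rewrite lerD2r].
    have [/andP[u0 ul] _] := xr; move: yr1; rewrite yv => /rep_PV[] [-> Ev];
    right; exists e1, u; split=> //; [left|right]; split=> //.
      by rewrite subr0 ger0_norm.
    by rewrite distrC ger0_norm // subr_ge0.
  move: yl; rewrite yv => /leg_PV[[d20 va]|sd2].
    right; exists v, d1, `|t - t'|; split; [by rewrite va|exact: vleg|].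
    by rewrite lerD2r; rewrite d20 addr0 in dz.
  exfalso; have := leg_ge0 xl; have := normr_ge0 (t - t'); lra.
- have [/andP[t'0 t'l] _] := y'r.
  case: W => [[e1 [u [u1 [xr yr1 uz]]]]|[a [d1 [d2 [xl yl dz]]]]].
    move: yr1; rewrite yE => /rep_PE[E1 E2 _]; subst e1 u1.
    left; exists e, u, t'; split=> //; apply: le_trans (ler_distD t _ _) _.
    by rewrite lerD2r.
  move: yl; rewrite yE => -[[]//|[e1 [u [/rep_PE[E1 E2 _]]]]]; subst e1 u.
  case=> -[Ea d2E]; right; exists a, d1.
    exists t'; split=> //; first by right; exists e, t'; split=> //; left.
    have := ler_norm (t' - t); rewrite distrC; lra.
  exists (len e - t'); split=> //; first by right; exists e, t'; split=> //; right.
  have := ler_norm (t - t'); lra.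
Qed.

End Metric.

(** * Subdividing the edges into cells *)

Ltac nat_lia := repeat match goal with
  | H : context [@Order.le] |- _ => clear H
  | H : context [@Order.lt] |- _ => clear H
  end; lia.

(** * Closed connected sets described by a type and finitely many lengths *)

Section Subcake.
Context {R : realType} {V E : finType} (ends : E -> V * V) (len : E -> R) (s : R).
Hypothesis s_gt0 : 0 < s.
Hypothesis s_len : forall e, s <= len e.
Local Notation point := (cake_pt R V E).
Local Notation pt := (@pt_at R V E ends len).
Local Notation rep := (@rep R V E ends len).
Local Notation seg := (@seg R V E ends len).

(* A closed connected set: a segment of one edge, or vertices [W] together with an
   initial part of every edge leaving [W] and a final part of every edge entering it. *)
Definition subcake (o : option E) (W : {set V}) (a b : E -> R) : set point :=
  if o is Some e then seg e (a e) (b e) else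
  [set PV v | v in [set w | w \in W]] `|`
  [set p | exists e t, rep p e t /\
     (((ends e).1 \in W /\ t <= a e) \/ ((ends e).2 \in W /\ b e <= t))].

(** [F] consists of full edges that connect [W]. The discrete data ranges over a finite set and the
    conditions on [a] and [b] are closed, so validity survives limits. *)
Definition valid_data (o : option E) (W : {set V}) (F : {set E}) (a b : E -> R) : Prop :=
  [/\ (forall e, 0 <= a e <= len e), (forall e, 0 <= b e <= len e) &
      o = None ->
        (forall w w', w \in W -> w' \in W ->
           exists2 l, is_walk ends w w' l & {subset l <= F}) /\
        (forall e, e \in F -> (ends e).1 \in W /\ a e = len e)].

Lemma in_seg e a b t : 0 <= t <= len e -> Num.min a b <= t <= Num.max a b ->
  seg e a b (pt e t).
Proof. by move=> tl tab; exists t. Qed.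

Lemma segS e a b a' b' : Num.min a b <= Num.min a' b' -> Num.max a' b' <= Num.max a b ->
  seg e a' b' `<=` seg e a b.
Proof.
move=> H1 H2 _ [t [/andP[t1 t2] tl] <-]; apply: in_seg => //.
by rewrite (le_trans H1 t1) (le_trans t2 H2).
Qed.

Lemma subcake_piece o W a b : (forall e, 0 <= a e <= len e) -> (forall e, 0 <= b e <= len e) ->
  is_piece ends len (subcake o W a b).
Proof.
move=> al bl; case: o => [e|] /=.
  exists [:: (e, `[Num.min (a e) (b e), Num.max (a e) (b e)])], finset.set0; split.
    move=> ei; rewrite inE => /eqP-> /= t; rewrite /= in_itv /= ge_min le_max.
    have /andP[a0 a1] := al e; have /andP[b0 b1] := bl e.
    case/andP => t1 t2; apply/andP; split.
      by case/orP: t1 => ?; [apply: le_trans a0 _|apply: le_trans b0 _].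
    by case/orP: t2 => ?; [apply: le_trans a1|apply: le_trans b1].
  apply/seteqP; split=> [p [t [tab tl] <-]|p].
    left; exists (e, `[Num.min (a e) (b e), Num.max (a e) (b e)]).
      by rewrite /= inE.
    by exists t => //=; rewrite in_itv.
  case=> [[_ /= /[!inE]/eqP-> [t /= ]]|[v /=]]; last by rewrite finset.inE.
  rewrite in_itv /= => tab <-; apply: in_seg => //.
  have /andP[a0 a1] := al e; have /andP[b0 b1] := bl e; case/andP: tab.
  rewrite ge_min le_max => t1 t2; apply/andP; split.
    by case/orP: t1 => ?; [apply: le_trans a0 _|apply: le_trans b0 _].
  by case/orP: t2 => ?; [apply: le_trans a1|apply: le_trans b1].
exists ([seq (e, `[0, a e]) | e <- enum [pred e | (ends e).1 \in W]] ++
        [seq (e, `[b e, len e]) | e <- enum [pred e | (ends e).2 \in W]]), W; split.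
  move=> ei; rewrite mem_cat => /orP[] /mapP[e _ ->] t /=; rewrite in_itv /= => /andP[t1 t2].
    by rewrite t1 (le_trans t2) //; have /andP[] := al e.
  by rewrite t2 andbT (le_trans _ t1) //; have /andP[] := bl e.
rewrite setUC; congr (_ `|` _); apply/seteqP; split=> p.
  move=> [e [t [[/andP[t0 tl] <-] [[eW ta]|[eW tb]]]]].
    exists (e, `[0, a e]); last by exists t; rewrite //= in_itv /= t0.
    by rewrite /= mem_cat; apply/orP; left; apply: map_f; rewrite mem_enum.
  exists (e, `[b e, len e]); last by exists t; rewrite //= in_itv /= tb.
  by rewrite /= mem_cat; apply/orP; right; apply: map_f; rewrite mem_enum.
case=> -[e I] /=; rewrite mem_cat => /orP[] /mapP[e']; rewrite mem_enum /= => eW [-> ->] [t /=];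
  rewrite in_itv /= => /andP[t1 t2] <-; exists e', t; split.
- by split=> //; rewrite t1 (le_trans t2) //; have /andP[] := al e'.
- by left.
- by split=> //; rewrite t2 andbT (le_trans _ t1) //; have /andP[] := bl e'.
- by right.
Qed.

(** Each point runs along its own edge to a vertex of [W], and vertices of [W] are joined through
    [F], whose edges lie inside the set because [a e = len e]. *)
Lemma subcake_connected o W F a b : valid_data o W F a b ->
  connected_piece ends len (subcake o W a b).
Proof.
move=> [al bl oP]; split; first exact: subcake_piece.
case: o oP => [e _|/(_ erefl)[walk FP]] x y /=.
  move=> [t [tab tl] <-] [t' [t'ab t'l] <-]; right; left; exists e, t, t'.
  split=> //; split=> //; apply: segS.
    by case/andP: tab => ? _; case/andP: t'ab => ? _; rewrite le_min; apply/andP.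
  by case/andP: tab => _ ?; case/andP: t'ab => _ ?; rewrite ge_max; apply/andP.
have reach z : subcake None W a b z -> exists2 w, w \in W &
    reach_in ends len (subcake None W a b) z w.
  case=> [[w /= wW <-]|[e [t [zr H]]]]; first by exists w => //; left.
  have [/andP[t0 tl] _] := zr.
  case: H => -[eW te]; [exists (ends e).1 => //|exists (ends e).2 => //];
    right; exists e, t; split=> //; [left|right]; split=> // _ [u [/andP[u1 u2] ul] <-];
    right; exists e, u; split=> //; [left|right]; split=> //.
    by move: u2; rewrite (max_idPr t0) => /le_trans; apply.
  by move: u1; rewrite (min_idPl tl); apply: le_trans.
move=> /reach[w wW xw] /reach[w' w'W yw]; right; right.
have [l lw lF] := walk _ _ wW w'W; exists w, w', l; do 3!split=> //.
move=> e /lF /FP[eW ae] _ [u [_ ul] <-]; right; exists e, u; split=> //; left; split=> //.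
by rewrite ae; case/andP: ul.
Qed.

End Subcake.

(** * The grid graph on vertices and cells, and its distances *)

Section Grid.
Context {R : realType} {V E : finType} (ends : E -> V * V) (len : E -> R) (s : R).
Hypothesis s_gt0 : 0 < s.
Hypothesis s_len : forall e, s <= len e.
Local Notation point := (cake_pt R V E).
Local Notation pt := (@pt_at R V E ends len).
Local Notation rep := (@rep R V E ends len).
Local Notation leg := (@leg R V E ends len).
Local Notation seg := (@seg R V E ends len).

Context (K : nat) (k : E -> nat) (h h' : R).
Hypothesis k_gt0 : forall e, (0 < k e)%N.
Hypothesis k_leK : forall e, (k e <= K)%N.
Hypothesis h_gt0 : 0 < h.
Let c (e : E) : R := len e / (k e)%:R.
Hypothesis hc : forall e, h <= c e <= h'.

(* [inr (e, i)] stands for the [i]-th cell of [e]; it is isolated junk if [k e <= i]. *)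
Definition node : finType := (V + E * 'I_K.+1)%type.

Definition cell (e : E) (i : nat) : node := inr (e, inord i).

(** When [k e] is one, the only cell of [e] touches both ends. *)
Definition end_cell (v : V) (e : E) (i : nat) : bool :=
  (i < k e)%N && (((i == 0)%N && ((ends e).1 == v)) || ((i.+1 == k e) && ((ends e).2 == v))).

Definition nadj : rel node := fun x y =>
  match x, y with
  | inl v, inr (e, i) => end_cell v e i
  | inr (e, i), inl v => end_cell v e i
  | inr (e, i), inr (e', j) =>
      [&& e == e', (i < k e)%N, (j < k e)%N & (i.+1 == j :> nat) || (j.+1 == i :> nat)]
  | _, _ => false
  end.

Definition nset (x : node) : set point :=
  match x with
  | inl v => [set PV v]
  | inr (e, i) => if (i < k e)%N then seg e (i%:R * c e) (i.+1%:R * c e) else set0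
  end.

Definition carrier (X : {set node}) : set point :=
  \bigcup_(x in [set x | x \in X]) nset x.

Lemma nadj_sym : symmetric nadj.
Proof.
move=> [v|[e i]] [w|[e' j]] //=; rewrite [e' == e]eq_sym; case: eqP => //= <-.
by rewrite orbC; case: (i < k e)%N; case: (j < k e)%N.
Qed.

Lemma cell_val e i : (i < k e)%N -> (inord i : 'I_K.+1) = i :> nat.
Proof. by move=> ik; rewrite inordK // ltnS ltnW // (leq_trans ik). Qed.

Lemma cell_inr e (i : 'I_K.+1) : inr (e, i) = cell e i.
Proof. by rewrite /cell inord_val. Qed.

Lemma c_gt0 e : 0 < c e.
Proof. by have /andP[hce _] := hc e; apply: lt_le_trans hce. Qed.

Lemma kc e : (k e)%:R * c e = len e.
Proof. by rewrite mulrC divfK // pnatr_eq0 -lt0n. Qed.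

Lemma leq_c e (i j : nat) : (i <= j)%N -> i%:R * c e <= j%:R * c e.
Proof. by move=> ij; rewrite ler_pM2r ?c_gt0 // ler_nat. Qed.

Lemma ic_bounds e i : (i <= k e)%N -> 0 <= i%:R * c e <= len e.
Proof.
move=> ik; rewrite -(kc e) leq_c // andbT.
by rewrite mulr_ge0 // ltW // c_gt0.
Qed.

Lemma in_cell e i p : (i < k e)%N -> nset (cell e i) p <->
  exists t, rep p e t /\ i%:R * c e <= t <= i.+1%:R * c e.
Proof.
move=> ik; rewrite /cell /= (cell_val ik) ik /Defs.seg /=.
have le : i%:R * c e <= i.+1%:R * c e by apply: leq_c.
rewrite (min_idPl le) (max_idPr le).
by split=> [[t [it tl] <-]|[t [[tl <-] it]]]; exists t.
Qed.

Lemma cell_ind (P : node -> Prop) : (forall v, P (inl v)) ->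
  (forall e i, (i < k e)%N -> P (cell e i)) ->
  (forall e i, (k e <= i < K.+1)%N -> P (cell e i)) -> forall x, P x.
Proof.
move=> Pv Pc Pj [v|[e i]]; first exact: Pv; rewrite cell_inr.
by have [ik|ki] := ltnP i (k e); [exact: Pc | apply: Pj; rewrite ki /=].
Qed.

Lemma junk_cell e i p : (k e <= i < K.+1)%N -> ~ nset (cell e i) p.
Proof. by case/andP=> ki iK; rewrite /cell /= inordK // ltnNge ki. Qed.

Lemma nadj_cell e i : (i.+1 < k e)%N -> nadj (cell e i) (cell e i.+1).
Proof. by move=> ik; rewrite /cell /= (cell_val ik) (cell_val (ltnW ik)) ik eqxx (ltnW ik) eqxx. Qed.

Lemma nadj_end v e i : (i < k e)%N -> nadj (inl v) (cell e i) = end_cell v e i.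
Proof. by move=> ik; rewrite /cell /= (cell_val ik). Qed.

Lemma end_cell1 e : end_cell (ends e).1 e 0.
Proof. by rewrite /end_cell k_gt0 !eqxx. Qed.

Lemma end_cell2 e : end_cell (ends e).2 e (k e).-1.
Proof. by rewrite /end_cell prednK ?k_gt0 // leqnn !eqxx orbT. Qed.

Lemma vertex_cell e i v : (i < k e)%N -> nset (cell e i) (PV v) -> end_cell v e i.
Proof.
move=> ik; rewrite (in_cell _ ik) => -[t [/(rep_PV s_gt0 s_len) tv /andP[it ti]]].
rewrite /end_cell ik /=; case: tv => -[tE <-]; rewrite eqxx ?andbT; apply/orP; [left|right].
  rewrite -leqn0 -(ler_nat R) -(ler_pM2r (c_gt0 e)) mul0r -tE //.
rewrite eqn_leq ik /= -(ler_nat R) -(ler_pM2r (c_gt0 e)) kc -tE //.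
Qed.

Lemma end_cell_vertex e i v : end_cell v e i -> nset (cell e i) (PV v).
Proof.
move=> /andP[ik ev]; rewrite (in_cell _ ik).
case/orP: ev => /andP[/eqP iE /eqP <-].
  exists 0; rewrite iE mul0r lexx mulr_ge0 ?(ltW (c_gt0 e)) //; split=> //.
  by split; [rewrite lexx (ltW (len_gt0 s_gt0 s_len e)) | exact: pt0].
exists (len e); rewrite iE kc lexx andbT; split; last by have /andP[] := ic_bounds (ltnW ik).
by split; [rewrite lexx (ltW (len_gt0 s_gt0 s_len e)) | exact: (ptlen ends s_gt0 s_len)].
Qed.

Local Notation containing p := (fun z : node => `[< nset z p >]).

(** A vertex of the cake serves as the middle node. An interior point lies in one cell or in two
    consecutive ones. *)
Lemma common_nodes x y p : nset x p -> nset y p -> joined nadj (containing p) 2 x y.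
Proof.
have vtx v z : nset z (PV v) -> joined nadj (containing (PV v)) 1 (inl v) z.
  elim/cell_ind: z => [w|e i ik|e i ki]; last by move/(junk_cell ki).
    move=> [->]; apply: (@joined_mono _ nadj (containing (PV w)) _ 0) => //.
    by apply: joined_refl; apply/asboolP.
  move=> zv; apply: joined1; last by apply/asboolP.
    by rewrite nadj_end //; apply: vertex_cell.
  by apply/asboolP.
case: p => [v|e0 t0].
  move=> xv yv; apply: (@joined_trans _ _ _ 1 1) (vtx _ _ yv).
  exact: (joined_sym nadj_sym (vtx _ _ xv)).
have mono m : (m <= 2)%N -> joined nadj (containing (PE e0 t0)) m x y ->
    joined nadj (containing (PE e0 t0)) 2 x y by move=> m2; apply: joined_mono.
elim/cell_ind: x mono => [w|e i ik|e i ki]; [by []| |by move=> _ /(junk_cell ki)].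
elim/cell_ind: y => [w|e' j jk|e' j kj]; [by []| |by move=> _ _ /(junk_cell kj)].
move=> mono xp yp; move: (xp) (yp); rewrite (in_cell _ ik) (in_cell _ jk).
move=> [t [/(rep_PE s_gt0 s_len)[E1 E2 _] /andP[it ti]]].
move=> [t' [/(rep_PE s_gt0 s_len)[E3 E4 _] /andP[jt tj]]]; subst e e' t t'.
have ij : (i <= j.+1)%N.
  by rewrite -(ler_nat R) -(ler_pM2r (c_gt0 e0)); apply: le_trans tj.
have ji : (j <= i.+1)%N.
  by rewrite -(ler_nat R) -(ler_pM2r (c_gt0 e0)); apply: le_trans ti.
have [eij|ne] := eqVneq i j.
  by rewrite -eij in mono *; apply: (mono 0%N) => //; apply: joined_refl; apply/asboolP.
apply: (mono 1%N) => //; apply: joined1; try by apply/asboolP.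
by rewrite /cell /= (cell_val ik) (cell_val jk) eqxx ik jk /=; nat_lia.
Qed.

Lemma cells_joined (Q : pred node) e i j : (i <= j < k e)%N ->
  (forall l, (i <= l <= j)%N -> Q (cell e l)) ->
  joined nadj Q (j - i) (cell e i) (cell e j).
Proof.
case/andP=> ij jk Qij; have [n En] : exists n, j = (i + n)%N by exists (j - i)%N; nat_lia.
rewrite {}En in ij jk Qij *; rewrite addKn.
elim: n ij jk Qij => [|n IH] ij jk Qij.
  by rewrite addn0; apply: joined_refl; apply: Qij; nat_lia.
rewrite -addn1; apply: (@joined_trans _ _ _ n 1 _ (cell e (i + n))).
  by apply: IH => [||l il]; [nat_lia|nat_lia|apply: Qij; nat_lia].
apply: joined1; try by apply: Qij; nat_lia.
by rewrite addn1 addnS; apply: nadj_cell; nat_lia.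
Qed.

Lemma cell_at e t : 0 <= t <= len e ->
  exists2 i, (i < k e)%N & i%:R * c e <= t <= i.+1%:R * c e.
Proof.
case/andP => t0 tl; have tc : 0 <= t / c e by rewrite divr_ge0 // ltW // c_gt0.
have /andP[n1 n2] := truncn_itv tc; rewrite ler_pdivlMr ?c_gt0 // in n1.
rewrite ltr_pdivrMr ?c_gt0 // in n2; move: (Num.truncn _) n1 n2 => n n1 n2.
have [nk|kn] := ltnP n (k e); first by exists n => //; rewrite n1 ltW.
exists (k e).-1; first by rewrite prednK ?k_gt0.
rewrite prednK ?k_gt0 // kc tl andbT; apply: le_trans n1; apply: leq_c; nat_lia.
Qed.

Lemma same_node x p q : nset x p -> nset x q ->
  p = q \/ exists e t t', [/\ rep p e t, rep q e t' & `|t - t'| <= h'].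
Proof.
elim/cell_ind: x => [v|e i ik|e i ki]; last by move/(junk_cell ki).
  by move=> -> ->; left.
rewrite !(in_cell _ ik) => -[t [pr /andP[it ti]]] [t' [qr /andP[it' t'i]]].
right; exists e, t, t'; split=> //; have /andP[_ ch] := hc e.
move: ti t'i; rewrite -natr1 mulrDl mul1r => ti t'i.
by rewrite ler_norml; apply/andP; split; lra.
Qed.

Lemma nadj_meet x y : nadj x y -> exists p, nset x p /\ nset y p.
Proof.
elim/cell_ind: x => [v|e i ik|e i /andP[ki iK]].
- elim/cell_ind: y => [w //|e i ik|e i /andP[ki iK]].
    by rewrite nadj_end // => /end_cell_vertex ?; exists (PV v).
  by rewrite /cell /= /end_cell inordK // ltnNge ki.
- elim/cell_ind: y => [w|e' j jk|e' j /andP[kj jK]].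
  + by rewrite nadj_sym nadj_end // => /end_cell_vertex ?; exists (PV w).
  + move=> adj; have [ee' ij] : e = e' /\ (i.+1 == j) || (j.+1 == i).
      move: adj; rewrite /cell /= (cell_val ik) (cell_val jk).
      by case/and4P => /eqP.
    move: jk ij {adj}; rewrite -ee' => jk ij.
    have lec l : l%:R * c e <= l.+1%:R * c e by apply: leq_c.
    case/orP: ij => /eqP E'.
      exists (pt e (j%:R * c e)); rewrite (in_cell _ ik) (in_cell _ jk) -E'.
      have B : 0 <= i.+1%:R * c e <= len e by apply: ic_bounds.
      by split; exists (i.+1%:R * c e); rewrite lexx lec; split=> //; split.
    exists (pt e (i%:R * c e)); rewrite (in_cell _ ik) (in_cell _ jk) -E'.
    have B : 0 <= j.+1%:R * c e <= len e by apply: ic_bounds.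
    by split; exists (j.+1%:R * c e); rewrite lexx lec; split=> //; split.
  + by rewrite /cell /= => /and4P[/eqP -> _]; rewrite inordK // ltnNge kj.
- by case: y => [w|[e' j]]; rewrite /cell /= /end_cell inordK // ltnNge ki /= ?andbF.
Qed.

Lemma dist_le0 p z : cake ends len p -> 0 <= z -> dist_le ends len z p p.
Proof.
move=> [[v _ <-]|[e _ [t [_ tl] <-]]] z0.
  by right; exists v, 0, 0; split; rewrite ?addr0 //; left.
by left; exists e, t, t; rewrite subrr normr0; split.
Qed.

Lemma nset_cake x p : nset x p -> cake ends len p.
Proof.
elim/cell_ind: x => [v ->|e i ik|e i ki]; last by move/(junk_cell ki).
  by left; exists v.
rewrite (in_cell _ ik) => -[t [[tl <-] _]]; right; exists e => //; exists t => //=.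
have l0 := ltW (len_gt0 s_gt0 s_len e).
by rewrite (min_idPl l0) (max_idPr l0).
Qed.

(** Consecutive nodes share a point, and crossing each of the [(size p).+1] nodes costs at most
    [h']; the total below [s] is what [dist_le_step] asks for. *)
Lemma path_dist_le x p a b : 0 <= h' -> path nadj x p -> nset x a -> nset (last x p) b ->
  (size p).+1%:R * h' < s -> dist_le ends len ((size p).+1%:R * h') a b.
Proof.
move=> h'0; elim: p x a => [|y p IH] x a /=.
  move=> _ xa xb; rewrite mul1r => hs.
  case: (same_node xa xb) => [<-|[e [t [t' [ar br tt]]]]].
    exact: dist_le0 (nset_cake xa) h'0.
  by left; exists e, t, t'.
case/andP => xy yp xa yb; rewrite -natr1 mulrDl mul1r => ps.
have [g [xg yg]] := nadj_meet xy.
have W : dist_le ends len ((size p).+1%:R * h') g b by apply: (IH y) => //; lra.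
case: (same_node xg xa) => [<-|[e [t [t' [gr ar tt]]]]].
  by apply: dist_le_mono W; lra.
apply: dist_le_sym; apply: (@dist_le_mono _ _ _ _ _ ((size p).+1%:R * h' + `|t - t'|)).
  by lra.
apply: (dist_le_step s_gt0 s_len (dist_le_sym W) gr ar); lra.
Qed.

(** The converse estimate. A leg costs at most [4] extra hops: two to reach a cell of the right
    edge, one for rounding, one from the last cell to the vertex. Two legs give [8]; a path inside
    one edge needs only [5]. *)
Lemma dist_le_joined z p q x y : dist_le ends len z p q -> nset x p -> nset y q ->
  exists2 m, joined nadj predT m x y & m%:R * h <= z + 8%:R * h.
Proof.
have any m a b (Q : pred node) : joined nadj Q m a b -> joined nadj predT m a b.
  exact: joined_mono.
have cells e (t t' : R) i j : (i < k e)%N -> (j < k e)%N ->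
    i%:R * c e <= t <= i.+1%:R * c e -> j%:R * c e <= t' <= j.+1%:R * c e ->
    exists2 m, joined nadj predT m (cell e i) (cell e j) & m%:R * h <= `|t - t'| + h.
  move=> ik jk it jt'; have /andP[hce _] := hc e.
  wlog ij : t t' i j ik jk it jt' / (i <= j)%N => [wl|].
    have [ij|/ltnW ji] := leqP i j; first exact: (wl t t').
    have [m xm mb] := wl t' t j i jk ik jt' it ji.
    by exists m; [apply: (joined_sym nadj_sym)|rewrite distrC].
  exists (j - i)%N; first by apply: cells_joined => //; rewrite ij.
  have ji : (j - i)%:R * c e <= `|t - t'| + c e.
    move: it jt' => /andP[_ ti] /andP[jt' _]; rewrite natrB // mulrBl.
    rewrite -natr1 mulrDl mul1r in ti.
    have := ler_norm (t' - t); rewrite distrC; lra.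
  (* A cell may be longer than [h], so one cell is set aside first: the other [j - i - 1] cells fit
     between [t] and [t'], and the one set aside counts as a single [h]. *)
  have [->|n0] := posnP (j - i).
    by rewrite mul0r addr_ge0 // ltW.
  rewrite -(prednK n0) -natr1 !mulrDl !mul1r in ji *.
  rewrite lerD2r; apply: le_trans (_ : (j - i).-1%:R * c e <= _); last by lra.
  by rewrite ler_wpM2l.
have legj a (d : R) p0 x0 : leg p0 a d -> nset x0 p0 ->
    exists2 m, joined nadj predT m x0 (inl a) & m%:R * h <= d + 4%:R * h.
  case=> [[-> ->]|[e [t [pr H]]]] xp.
    exists 2%N; last by rewrite add0r ler_wpM2r ?ler_nat // ltW.
    by apply: any (common_nodes xp _).
  have [tl _] := pr; have [i ik it] := cell_at tl.
  have xi : joined nadj predT 2 x0 (cell e i).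
    by apply: any (common_nodes xp _); rewrite (in_cell _ ik); exists t.
  have step j (v : V) (u : R) : end_cell v e j -> 0 <= u <= len e ->
       j%:R * c e <= u <= j.+1%:R * c e ->
    exists2 m, joined nadj predT m x0 (inl v) & m%:R * h <= `|t - u| + 4%:R * h.
    move=> ev ul ju; have jk : (j < k e)%N by case/andP: ev.
    have [m ij mb] := cells e t u i j ik jk it ju.
    exists (2 + (m + 1))%N; last by rewrite !natrD; lra.
    apply: joined_trans xi _; apply: joined_trans ij _; apply: joined1 => //.
    by rewrite nadj_sym nadj_end.
  case: H => -[Ea dE].
    have [] := step 0%N a 0; rewrite -?Ea; first exact: end_cell1.
    - by rewrite lexx (ltW (len_gt0 s_gt0 s_len e)).
    - by rewrite mul0r lexx mul1r (ltW (c_gt0 e)).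
    by move=> m jm mb; exists m => //; move: mb; rewrite subr0 dE ger0_norm //; case/andP: tl.
  have [] := step (k e).-1 a (len e); rewrite -?Ea; first exact: end_cell2.
  - by rewrite lexx (ltW (len_gt0 s_gt0 s_len e)).
  - by rewrite prednK ?k_gt0 // kc lexx andbT -[X in _ <= X]kc; apply: leq_c; apply: leq_pred.
  move=> m jm mb; exists m => //; move: mb; rewrite dE distrC ger0_norm // subr_ge0.
  by case/andP: tl.
have h0 := h_gt0.
move=> W xp yq; case: W => [[e [t [t' [pr qr tz]]]]|[a [d1 [d2 [pl ql dz]]]]].
  have [tl _] := pr; have [i ik it] := cell_at tl.
  have [t'l _] := qr; have [j jk jt'] := cell_at t'l.
  have [m ij mb] := cells e t t' i j ik jk it jt'.
  exists (2 + (m + 2))%N; last by rewrite !natrD; lra.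
  apply: (@joined_trans _ _ _ _ _ _ (cell e i)).
    by apply: any (common_nodes xp _); rewrite (in_cell _ ik); exists t.
  apply: joined_trans ij _.
  by apply: any (common_nodes _ yq); rewrite (in_cell _ jk); exists t'.
have [m xm mb] := legj _ _ _ _ pl xp; have [m' ym m'b] := legj _ _ _ _ ql yq.
exists (m + m')%N; last by rewrite natrD; lra.
by apply: joined_trans xm (joined_sym nadj_sym ym).
Qed.


Lemma rep_node p e t : rep p e t -> exists2 i, (i < k e)%N & nset (cell e i) p.
Proof.
move=> pr; have [tl _] := pr; have [i ik it] := cell_at tl.
by exists i => //; rewrite (in_cell _ ik); exists t.
Qed.

Lemma has_node p : cake ends len p -> exists x, nset x p.
Proof.
case=> [[v _ <-]|[e _ [t [_ tl] <-]]]; first by exists (inl v).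
by have [|i _ ?] := @rep_node (pt e t) e t; last exists (cell e i).
Qed.

Lemma piece_cake X p : is_piece ends len X -> X p -> cake ends len p.
Proof.
move=> [l [W [lP ->]]] [[ei /= /lP eil [t /eil/= tl <-]]|[v _ <-]]; last by left; exists v.
right; exists ei.1 => //; exists t => //=.
have l0 := ltW (len_gt0 s_gt0 s_len ei.1).
by rewrite (min_idPl l0) (max_idPr l0).
Qed.

Definition round (P : set point) : {set node} :=
  [set x : node | `[< exists p, P p /\ nset x p >]]%SET.

Lemma roundP P x : reflect (exists p, P p /\ nset x p) (x \in round P).
Proof. by rewrite finset.inE; apply: asboolP. Qed.

(** * Rounding a connected piece up to a connected set of nodes *)

Section Round.
Variable P : set point.

Definition linked (x y : node) : Prop := exists m, joined nadj (mem (round P)) m x y.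
(** Ranging over all nodes that contain the two points makes the relation composable along a path,
    whatever node was chosen at a junction. *)
Definition plinked (p q : point) : Prop := forall x y, nset x p -> nset y q -> linked x y.

Lemma linked_sym x y : linked x y -> linked y x.
Proof. by move=> [m xy]; exists m; apply: (joined_sym nadj_sym). Qed.

Lemma linked_trans x y z : linked x y -> linked y z -> linked x z.
Proof. by move=> [m xy] [m' yz]; exists (m + m')%N; apply: joined_trans yz. Qed.

Lemma plinked_sym p q : plinked p q -> plinked q p.
Proof. by move=> pq x y xq yp; apply/linked_sym/pq. Qed.

Lemma plinked_trans p q r : cake ends len q -> plinked p q -> plinked q r -> plinked p r.
Proof.
move=> /has_node[y yq] pq qr x z xp zr.
exact: linked_trans (pq _ _ xp yq) (qr _ _ yq zr).
Qed.

Lemma plinked_refl p : P p -> plinked p p.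
Proof.
move=> Pp x y xp yp; exists 2%N; apply: joined_mono (common_nodes xp yp) => // z.
by move/asboolP => zp; apply/roundP; exists p.
Qed.

Lemma plinked_seg e t t' : 0 <= t <= len e -> 0 <= t' <= len e -> seg e t t' `<=` P ->
  plinked (pt e t) (pt e t').
Proof.
move=> tl t'l; have [i ik it] := cell_at tl; have [j jk jt'] := cell_at t'l.
wlog ij : t t' i j tl t'l ik it jk jt' / (i <= j)%N => [wl tP|].
  have [ij|/ltnW ji] := leqP i j; first exact: (wl t t' i j).
  apply: plinked_sym; apply: (wl t' t j i) => //.
  by rewrite /Defs.seg minC maxC.
move=> tP; have Pt : P (pt e t).
  by apply/tP/in_seg => //; rewrite ge_min le_max lexx.
have Pt' : P (pt e t').
  by apply/tP/in_seg => //; rewrite ge_min le_max lexx !orbT.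
have inI : nset (cell e i) (pt e t) by rewrite (in_cell _ ik); exists t.
have inJ : nset (cell e j) (pt e t') by rewrite (in_cell _ jk); exists t'.
move=> x y xt yt'; apply: linked_trans (plinked_refl Pt xt inI) _.
apply: linked_trans (plinked_refl Pt' inJ yt').
exists (j - i)%N; apply: cells_joined; first by rewrite ij.
move=> l /andP[il lj]; apply/roundP.
have [li|ni] := eqVneq l i; first by exists (pt e t); rewrite li.
have [lj'|nj] := eqVneq l j; first by exists (pt e t'); rewrite lj'.
have lk : (l < k e)%N by nat_lia.
exists (pt e (l%:R * c e)); split; last first.
  by rewrite (in_cell _ lk); exists (l%:R * c e); rewrite lexx leq_c //; split=> //;
     split=> //; apply: ic_bounds; nat_lia.
apply/tP/in_seg; first by apply: ic_bounds; nat_lia.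
have A : t <= l%:R * c e.
  by case/andP: it => _ /le_trans; apply; apply: leq_c; nat_lia.
have B : l%:R * c e <= t'.
  by case/andP: jt' => + _; apply: le_trans; apply: leq_c; nat_lia.
by rewrite ge_min le_max A B orbT.
Qed.

Lemma plinked_reach p a : P p -> reach_in ends len P p a ->
  P (PV a) /\ plinked p (PV a).
Proof.
move=> Pp [pa|[e [t [[tl <-] H]]]]; first by rewrite -pa; split=> //; exact: plinked_refl.
have l0 := ltW (len_gt0 s_gt0 s_len e); have /andP[t0 t1] := tl.
case: H => -[<- tP].
  rewrite -(pt0 ends len e); split.
    by apply/tP/in_seg; rewrite ?lexx //= ge_min le_max lexx.
  by apply/plinked_sym/plinked_seg => //; rewrite lexx.
rewrite -(ptlen ends s_gt0 s_len e); split.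
  by apply/tP/in_seg; rewrite ?l0 ?lexx //= ge_min le_max lexx !orbT.
by apply: plinked_seg => //; rewrite l0 lexx.
Qed.

Lemma plinked_walk a b l : P (PV a) -> is_walk ends a b l ->
  (forall e, e \in l -> seg e 0 (len e) `<=` P) -> plinked (PV a) (PV b).
Proof.
elim: l a => [|e l IH] a Pa /=; first by move=> <- _; apply: plinked_refl.
move=> [x [ex xb]] lP.
have eP : seg e 0 (len e) `<=` P by apply: lP; rewrite mem_head.
have l0 := ltW (len_gt0 s_gt0 s_len e).
have Px : P (PV x).
  case: ex => ex; have := eP; [rewrite -[x]/((a, x).2) -ex -(ptlen ends s_gt0 s_len e)
    |rewrite -[x]/((x, a).1) -ex -(pt0 ends len e)]; apply; apply: in_seg;
    by rewrite ?l0 ?lexx //= ge_min le_max l0 lexx ?orbT.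
have ax : plinked (PV a) (PV x).
  have E12 : plinked (PV (ends e).1) (PV (ends e).2).
    rewrite -(ptlen ends s_gt0 s_len e) -(pt0 ends len e).
    by apply: plinked_seg => //; rewrite ?l0 ?lexx.
  by case: ex E12 => -> //= /plinked_sym.
apply: plinked_trans ax _; first by left; exists x.
by apply: IH => // e' e'l; apply: lP; rewrite inE e'l orbT.
Qed.

Lemma conn_round : connected_piece ends len P -> conn nadj (round P).
Proof.
move=> [PP Pc] x y /roundP[p [Pp xp]] /roundP[q [Pq yq]].
suff : plinked p q by apply.
case: (Pc p q Pp Pq) => [<-|[[e [t [t' [[tl <-] [[t'l <-] tP]]]]]|]].
- exact: plinked_refl.
- exact: plinked_seg.
move=> [a [b [l [pa [qb [wl lP]]]]]].
have [Pa pla] := plinked_reach Pp pa; have [Pb plb] := plinked_reach Pq qb.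
apply: plinked_trans pla _; first by left; exists a.
apply: plinked_trans (plinked_walk Pa wl lP) _; first by left; exists b.
exact: plinked_sym.
Qed.

End Round.

Lemma carrierS (X Y : {set node}) : X \subset Y -> carrier X `<=` carrier Y.
Proof. by move=> /fintype.subsetP XY p [x /= xX xp]; exists x => //=; apply: XY. Qed.

Lemma sub_carrier_round P : is_piece ends len P -> P `<=` carrier (round P).
Proof.
move=> PP p Pp; have [x xp] := has_node (piece_cake PP Pp).
by exists x => //=; apply/roundP; exists p.
Qed.

Lemma cell_range e n m t : (n < m <= k e)%N -> n%:R * c e <= t <= m%:R * c e ->
  exists i, [/\ (n <= i < m)%N & i%:R * c e <= t <= i.+1%:R * c e].
Proof.
move=> /andP[nm mk] /andP[nt tm].
have tl : 0 <= t <= len e.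
  have /andP[n0 _] : 0 <= n%:R * c e <= len e by apply: ic_bounds; nat_lia.
  have /andP[_ ml] : 0 <= m%:R * c e <= len e by apply: ic_bounds; nat_lia.
  by rewrite (le_trans n0 nt) (le_trans tm ml).
have [i ik /andP[it ti]] := cell_at tl.
have [ni|i_n] := leqP n i; last first.
  exists n; split; first by nat_lia.
  by rewrite nt (le_trans ti) //; apply: leq_c; nat_lia.
have [im|mi] := ltnP i m; first by exists i; rewrite ni im it ti.
exists m.-1; split; first by nat_lia.
rewrite prednK; last by nat_lia.
by rewrite tm andbT (le_trans _ it) //; apply: leq_c; nat_lia.
Qed.

(** * Connected sets of nodes as closed sets of the cake *)

Section ToData.
Variable X : {set node}.
Hypothesis X_conn : conn nadj X.

Lemma path_invariant (Inv : node -> Prop) x y : x \in X -> y \in X -> Inv x ->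
  (forall z z', nadj z z' -> z' \in X -> Inv z -> Inv z') -> Inv y.
Proof.
move=> xX yX Ix step; have [m [p [xp <- _ /= /andP[_ pX]]]] := X_conn xX yX.
elim: p x xp pX Ix {xX} => //= z p IH x /andP[xz zp] /andP[zX pX] Ix.
by apply: IH => //; apply: step Ix.
Qed.

Let full (e : E) : Prop := forall i, (i < k e)%N -> cell e i \in X.
Let W : {set V} := [set v | inl v \in X]%SET.
Let F : {set E} := [set e | [&& (ends e).1 \in W, (ends e).2 \in W & `[< full e >]]]%SET.

(* A path in [X] from a vertex to a cell enters the edge of that cell at one end. *)
Let Inv (w : V) (z : node) : Prop :=
  match z with
  | inl v => exists2 l, is_walk ends w v l & {subset l <= F}
  | inr (e, i) => (i < k e)%N /\ (
      (exists2 l, is_walk ends w (ends e).1 l & {subset l <= F}) /\ (ends e).1 \in W /\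
        (forall j, (j <= i)%N -> cell e j \in X) \/
      (exists2 l, is_walk ends w (ends e).2 l & {subset l <= F}) /\ (ends e).2 \in W /\
        (forall j, (i <= j < k e)%N -> cell e j \in X))
  end.

Lemma walk_rcons w u v e l : is_walk ends w u l -> {subset l <= F} -> e \in F ->
  ends e = (u, v) \/ ends e = (v, u) ->
  exists2 l', is_walk ends w v l' & {subset l' <= F}.
Proof.
move=> wl lF eF ev; exists (rcons l e).
  by rewrite -cats1; apply/is_walk_cat; exists u; split=> //=; exists v.
by move=> x; rewrite mem_rcons inE => /orP[/eqP->|/lF].
Qed.

Lemma inv_step w z z' : w \in W -> nadj z z' -> z \in X -> z' \in X -> Inv w z -> Inv w z'.
Proof.
move=> wW; case: z => [v|[e i]]; case: z' => [v'|[e' j]] //.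
- move=> /= /andP[ik ev] vX zX wv; split=> //.
  have vW : v \in W by rewrite finset.inE.
  case/orP: ev => /andP[/eqP iE /eqP Ev]; rewrite Ev; [left|right]; do 2!split=> //.
    move=> l; rewrite iE leqn0 => /eqP->.
    by have -> : cell e' 0 = inr (e', j) by rewrite -iE -cell_inr.
  move=> l lk; have -> : l = j by nat_lia.
  by rewrite -cell_inr.
- move=> /= /andP[_ ev] _ vX [ik H].
  have vW : v' \in W by rewrite finset.inE.
  case/orP: ev => /andP[/eqP iE /eqP Ev]; case: H => -[[l wl lF] [eW H]].
  + by exists l; rewrite // -Ev.
  + apply: (walk_rcons wl lF (e := e)); last by right; rewrite -Ev; case: (ends e).
    rewrite finset.inE Ev vW eW; apply/asboolP => l' l'k; apply: H; by rewrite iE.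
  + apply: (walk_rcons wl lF (e := e)); last by left; rewrite -Ev; case: (ends e).
    rewrite finset.inE Ev vW eW; apply/asboolP => l' l'k; apply: H; nat_lia.
  + by exists l; rewrite // -Ev.
- move=> /= /and4P[/eqP <- ik jk ij] _ zX [_ H]; split=> //.
  have jX : cell e j \in X by rewrite -cell_inr.
  case: H => -[wl [eW H]]; [left|right]; do 2!split=> //.
    by move=> l lj; have [->//|lj'] := eqVneq l j; apply: H; nat_lia.
  by move=> l lj; have [->//|lj'] := eqVneq l j; apply: H; nat_lia.
Qed.

Lemma prefix_exists e : exists n, [/\ (n <= k e)%N, forall i, (i < n)%N -> cell e i \in X &
  (n < k e)%N -> cell e n \notin X].
Proof.
pose Q n := (n <= k e)%N && `[< forall i, (i < n)%N -> cell e i \in X >].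
have Q0 : exists n, Q n by exists 0%N; apply/andP; split=> //; apply/asboolP.
have Qb n : Q n -> (n <= k e)%N by case/andP.
case: (ex_maxnP Q0 Qb) => n /andP[nk /asboolP nX] nmax; exists n; split=> // nk'.
apply/negP => nX'; suff /nmax : Q n.+1 by rewrite ltnn.
rewrite /Q nk'; apply/asboolP => i; rewrite ltnS leq_eqVlt => /orP[/eqP->//|]; exact: nX.
Qed.

Lemma suffix_exists e : exists n, [/\ (n <= k e)%N,
  forall i, (n <= i < k e)%N -> cell e i \in X &
  (0 < n)%N -> cell e n.-1 \notin X].
Proof.
pose Q n := (n <= k e)%N && `[< forall i, (n <= i < k e)%N -> cell e i \in X >].
have Q0 : exists n, Q n by exists (k e); rewrite /Q leqnn; apply/asboolP => i; nat_lia.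
case: (ex_minnP Q0) => n /andP[nk /asboolP nX] nmin; exists n; split=> // n0.
apply/negP => nX'; suff /nmin : Q n.-1 by nat_lia.
rewrite /Q (leq_trans (leq_pred _) nk); apply/asboolP => i /andP[ni ik].
have [->//|ne] := eqVneq i n.-1; apply: nX; nat_lia.
Qed.

(** On each edge, [a] ends the longest initial run of cells in [X] and [b] begins the longest final
    run. By [Inv], every cell of [X] belongs to such a run starting from an end in [W]. *)
Lemma carrier_star w : w \in W -> exists a b,
  valid_data ends len None W F a b /\ subcake ends len None W a b = carrier X.
Proof.
move=> wW; have [pre preP] := choice prefix_exists; have [suf sufP] := choice suffix_exists.
have inv u z : u \in W -> z \in X -> Inv u z.
  move=> uW zX; have uX : inl u \in X by move: uW; rewrite finset.inE.
  suff [] : z \in X /\ Inv u z by [].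
  apply: (path_invariant (Inv := fun z => z \in X /\ Inv u z) uX zX).
    by split=> //; exists [::].
  by move=> z1 z2 z12 z2X [z1X Iz]; split=> //; apply: inv_step z12 _ _ Iz.
exists (fun e => (pre e)%:R * c e), (fun e => (suf e)%:R * c e); split.
  split=> [e|e|_].
  - by apply: ic_bounds; case: (preP e).
  - by apply: ic_bounds; case: (sufP e).
  split=> [u u' uW u'W|e].
    by apply: (inv u (inl u')) => //; move: u'W; rewrite finset.inE.
  rewrite finset.inE => /and3P[e1 _ /asboolP fe]; split=> //.
  have [pk _ pN] := preP e; have [kp|pk'] := leqP (k e) (pre e).
    by rewrite -[RHS]kc; congr (_%:R * _); nat_lia.
  by have := pN pk'; rewrite fe.
apply/seteqP; split=> p.
  case=> [[v /= vW <-]|[e [t [pr H]]]].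
    by exists (inl v) => //=; move: vW; rewrite finset.inE.
  have [/andP[t0 tl] pE] := pr; case: H => -[eW te].
    (* An empty run leaves only the end vertex of the edge, which is covered by its own node. *)
    have [pk pX _] := preP e; have [p0|p0] := posnP (pre e).
      have t_0 : t = 0.
        by apply/eqP; rewrite eq_le t0 andbT; move: te; rewrite p0 mul0r.
      exists (inl (ends e).1); first by move: eW; rewrite finset.inE.
      by rewrite /= -pE t_0 pt0.
    have [||i [ip it]] := @cell_range e 0 (pre e) t; first by rewrite p0.
      by rewrite mul0r t0.
    have ik : (i < k e)%N by nat_lia.
    by exists (cell e i); [apply: pX; case/andP: ip|rewrite (in_cell _ ik); exists t].
  have [sk sX _] := sufP e; have [s0|s0] := leqP (k e) (suf e).
    have t_l : t = len e.
      apply/eqP; rewrite eq_le tl /= -[X in X <= _]kc; apply: le_trans te.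
      exact: leq_c.
    exists (inl (ends e).2); first by move: eW; rewrite finset.inE.
    by rewrite /= -pE t_l (ptlen ends s_gt0 s_len).
  have [||i [ip it]] := @cell_range e (suf e) (k e) t; first by rewrite s0 leqnn.
    by rewrite te kc.
  have ik : (i < k e)%N by nat_lia.
  by exists (cell e i); [apply: sX; nat_lia|rewrite (in_cell _ ik); exists t].
case=> x /= xX xp; have Ix := inv _ _ wW xX; elim/cell_ind: x xX xp Ix => [v|e i ik|e i ki].
- by move=> vX -> _; left; exists v => //=; rewrite finset.inE.
- move=> _; rewrite (in_cell _ ik) => -[t [pr /andP[it ti]]].
  rewrite /cell /= (cell_val ik) => -[_ [] [_ [eW H]]]; right; exists e, t; split=> //.
    left; split=> //; apply: le_trans ti _; apply: leq_c.
    have [pk _ pN] := preP e; rewrite ltnNge; apply/negP => pi.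
    by have := pN (leq_ltn_trans pi ik); rewrite H.
  right; split=> //; apply: le_trans it; apply: leq_c.
  have [sk _ sN] := sufP e; rewrite leqNgt; apply/negP => is_.
  by have := sN (leq_ltn_trans (leq0n i) is_); rewrite H //; nat_lia.
- by move=> _ /(junk_cell ki).
Qed.

(** Without vertices, hops only lead to neighbouring cells of the same edge, so [X] is a block of
    consecutive cells, here from [n] to [m - 1]. *)
Lemma carrier_segment e i : (forall v, inl v \notin X) -> (i < k e)%N -> cell e i \in X ->
  exists n m, [/\ (n <= m <= k e)%N & seg e (n%:R * c e) (m%:R * c e) = carrier X].
Proof.
move=> noV ik iX.
pose J (z : node) := exists j, [/\ z = cell e j, (j < k e)%N &
  forall l, (minn i j <= l <= maxn i j)%N -> cell e l \in X].
have inv z : z \in X -> J z.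
  move=> zX; apply: (path_invariant (Inv := J) iX zX).
    by exists i; split=> // l; rewrite minnn maxnn => il; have -> : l = i by nat_lia.
  move=> z1 z2 z12 z2X [j [E1 jk jX]]; move: z12; rewrite E1.
  elim/cell_ind: z2 z2X => [v|e' j' jk'|e' j' /andP[kj' jK']].
  - by move=> vX; have := noV v; rewrite vX.
  - move=> j'X; rewrite /cell /= (cell_val jk) (cell_val jk') => /and4P[/eqP ee' _ _ jj'].
    rewrite -{}ee' in j'X jk' *; exists j'; split=> // l lb.
    by have [->//|ne] := eqVneq l j'; apply: jX; nat_lia.
  - by move=> _; rewrite /cell /= => /and4P[/eqP -> _]; rewrite inordK // ltnNge kj'.
pose Q j := (j < k e)%N && (cell e j \in X).
have Q0 : exists j, Q j by exists i; rewrite /Q ik.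
have Qb j : Q j -> (j <= k e)%N by case/andP => /ltnW.
case: (ex_minnP Q0) => n /andP[nk nX] nmin; case: (ex_maxnP Q0 Qb) => m /andP[mk mX] mmax.
have nm : (n <= m)%N by apply: nmin; rewrite /Q mk.
have Xb l : (n <= l <= m)%N -> cell e l \in X.
  have [n' [En nk' H1]] := inv _ nX; have [m' [Em mk' H2]] := inv _ mX.
  have inj j j' : (j < k e)%N -> (j' < k e)%N -> cell e j = cell e j' -> j = j'.
    by move=> jk jk' [] /(congr1 val) /=; rewrite (cell_val jk) (cell_val jk').
  rewrite -(inj _ _ nk nk' En) in H1; rewrite -(inj _ _ mk mk' Em) in H2.
  by move=> nlm; have [li|il] := leqP l i; [apply: H1; nat_lia|apply: H2; nat_lia].
have le : n%:R * c e <= m.+1%:R * c e by apply: leq_c; nat_lia.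
exists n, m.+1; split; first by nat_lia.
apply/seteqP; split=> p.
  move=> [t [tb tl] <-]; rewrite (min_idPl le) (max_idPr le) in tb.
  have [|l [lb lt]] := @cell_range e n m.+1 t _ tb; first by nat_lia.
  have lk : (l < k e)%N by nat_lia.
  by exists (cell e l); [apply: Xb; nat_lia|rewrite (in_cell _ lk); exists t].
move=> [x /= xX]; have [j [xE jk _]] := inv _ xX; rewrite xE in xX *.
rewrite (in_cell _ jk) => -[t [[tl <-] /andP[jt tj]]]; exists t => //; split=> //.
rewrite (min_idPl le) (max_idPr le); apply/andP; split.
  by apply: le_trans jt; apply: leq_c; apply: nmin; rewrite /Q jk.
by apply: (le_trans tj); apply: leq_c; rewrite ltnS; apply: mmax; rewrite /Q jk.
Qed.

Lemma carrier_data : exists o W F a b,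
  valid_data ends len o W F a b /\ subcake ends len o W a b = carrier X.
Proof.
have [[w wW]|noV] := pselect (exists w, w \in W).
  by have [a [b H]] := carrier_star wW; exists None, W, F, a, b.
have {}noV v : inl v \notin X.
  by apply/negP => vX; apply: noV; exists v; rewrite finset.inE.
have len0 e : 0 <= (0 : R) <= len e by rewrite lexx (ltW (len_gt0 s_gt0 s_len e)).
have [[e [i [ik iX]]]|noC] := pselect (exists e i, (i < k e)%N /\ cell e i \in X).
  have [n [m [nm nmX]]] := carrier_segment noV ik iX.
  exists (Some e), finset.set0, finset.set0,
    (fun e' => if e' == e then n%:R * c e else 0),
    (fun e' => if e' == e then m%:R * c e else 0); split; last by rewrite /= eqxx.
  by split=> // e'; case: eqP => // ->; apply: ic_bounds; nat_lia.
(* Only junk nodes are left, and they carry no point, so the carrier is empty. *)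
exists None, finset.set0, finset.set0, (fun=> 0), (fun=> 0); split.
  by split=> // _; split=> [w w'|e]; rewrite finset.inE.
apply/seteqP; split=> p.
  by case=> [[v /=]|[e [t [_ [] []]]]]; rewrite finset.inE.
move=> [x /= xX]; elim/cell_ind: x xX => [v|e i ik|e i ki].
- by move=> vX; have := noV v; rewrite vX.
- by move=> iX; case: noC; exists e, i.
- by move=> _ /(junk_cell ki).
Qed.

End ToData.


(** * The parent map on the grid *)

Section Rooting.
Context (Z : {set V}) (dir : E -> bool) (d : V -> nat).
Hypothesis d_child : forall e, child ends dir e \notin Z ->
  (d (parent ends dir e) < d (child ends dir e))%N.
Hypothesis child_inj : forall e e', child ends dir e \notin Z ->
  child ends dir e = child ends dir e' -> e = e'.

Definition nodeZ : {set node} := [set (inl w : node) | w in Z]%SET.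

Definition first_cell (e : E) : node := if dir e then cell e 0 else cell e (k e).-1.

(** Cells move towards the parent end of their edge, and a vertex off [Z] enters the edge of which
    it is the child end. The roots are the vertices of [Z], the vertices that are no child end, and
    the junk nodes. *)
Definition npar (x : node) : node :=
  match x with
  | inl v => if v \in Z then inl v else
      if [pick e | child ends dir e == v] is Some e then first_cell e else inl v
  | inr (e, i) => if (i < k e)%N then
      if dir e then if i.+1 == k e then inl (ends e).2 else cell e i.+1
      else if i == 0 :> nat then inl (ends e).1 else cell e i.-1
    else inr (e, i)
  end.

(** An edge has at most [K] cells, so the factor [K.+2] leaves room for them strictly between the
    ranks of the parent end and of a child end off [Z]. *)
Definition nrank (x : node) : nat :=
  match x with
  | inl v => (d v * K.+2)%N
  | inr (e, i) => (d (parent ends dir e) * K.+2 + (if dir e then k e - i else i.+1))%N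
  end.

Lemma npar_cell e i : (i < k e)%N -> npar (cell e i) =
  if dir e then if i.+1 == k e then inl (ends e).2 else cell e i.+1
  else if i == 0 then inl (ends e).1 else cell e i.-1.
Proof. by move=> ik; rewrite /cell /= (cell_val ik) ik. Qed.

Lemma nrank_cell e i : (i < k e)%N -> nrank (cell e i) =
  (d (parent ends dir e) * K.+2 + (if dir e then k e - i else i.+1))%N.
Proof. by move=> ik; rewrite /cell /nrank (cell_val ik). Qed.

Lemma npar_junk e i : (k e <= i < K.+1)%N -> npar (cell e i) = cell e i.
Proof. by case/andP => ki iK; rewrite /cell /= inordK // ltnNge ki. Qed.

Lemma npar_vertex v : v \notin Z ->
  (exists2 e, child ends dir e = v & npar (inl v) = first_cell e) \/
  (npar (inl v) = inl v /\ forall e, child ends dir e != v).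
Proof.
move=> vZ; rewrite /= (negbTE vZ); case: pickP => [e /eqP ce|no]; first by left; exists e.
by right; split=> // e; rewrite no.
Qed.

Lemma npar_rank x : npar x = x \/ (nrank (npar x) < nrank x)%N.
Proof.
elim/cell_ind: x => [v|e i ik|e i ki]; last by left; apply: npar_junk.
  have [vZ|vZ] := boolP (v \in Z); first by left; rewrite /= vZ.
  case: (npar_vertex vZ) => [[e ce ->]|[-> _]]; last by left.
  right; have lt := d_child (e := e); rewrite ce vZ in lt; have {}lt := lt isT.
  have ke := k_gt0 e; have kK := k_leK e.
  have lt' : (d (parent ends dir e) * K.+2 + K.+2 <= d v * K.+2)%N.
    by rewrite -mulSnr leq_mul2r lt orbT.
  rewrite /first_cell; case dE : (dir e).
    by rewrite nrank_cell // dE /nrank; nat_lia.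
  rewrite nrank_cell; last by nat_lia.
  by rewrite dE /nrank; nat_lia.
right; rewrite npar_cell // nrank_cell //; case dE : (dir e).
  case: eqP => ike; last by rewrite nrank_cell ?dE; nat_lia.
  by rewrite /= /parent dE; nat_lia.
case: eqP => i0; first by rewrite /= /parent dE; nat_lia.
by rewrite nrank_cell ?dE; nat_lia.
Qed.

Lemma npar_edge x : npar x = x \/ nadj x (npar x).
Proof.
elim/cell_ind: x => [v|e i ik|e i ki]; last by left; apply: npar_junk.
  have [vZ|vZ] := boolP (v \in Z); first by left; rewrite /= vZ.
  case: (npar_vertex vZ) => [[e <- ->]|[-> _]]; last by left.
  right; rewrite /first_cell /child; case: (dir e).
    by rewrite nadj_end ?end_cell1 // k_gt0.
  by rewrite nadj_end ?end_cell2 // prednK // k_gt0.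
right; rewrite npar_cell //; case: (dir e).
  case: eqP => ike; last by apply: nadj_cell; nat_lia.
  by rewrite nadj_sym nadj_end // /end_cell ik ike !eqxx orbT.
case: eqP => i0; first by rewrite nadj_sym nadj_end // /end_cell ik i0 !eqxx.
rewrite nadj_sym -[in cell e i](prednK (n := i)); last by nat_lia.
by apply: nadj_cell; nat_lia.
Qed.

(** At a child end off [Z], injectivity of [child] identifies the edge that the vertex climbs; at a
    parent end, the cell climbs to the vertex. Only a child end in [Z] breaks this. *)
Lemma edge_npar x y : nadj x y -> [\/ x \in nodeZ, y \in nodeZ, npar x = y | npar y = x].
Proof.
have ve v e i : end_cell v e i -> [\/ (inl v : node) \in nodeZ,
    npar (inl v) = cell e i | npar (cell e i) = inl v].
  move=> /andP[ik ev].
  have [vZ|vZ] := boolP (v \in Z); first by constructor 1; apply: imset_f.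
  have child_case : child ends dir e = v -> npar (inl v) = first_cell e.
    move=> ce; case: (npar_vertex vZ) => [[e' ce' ->]|[_ /(_ e)]]; last by rewrite ce eqxx.
    congr first_cell; apply: child_inj; rewrite ce' //; exact: esym.
  rewrite npar_cell //; case/orP: ev => /andP[/eqP iE /eqP Ev]; case dE : (dir e).
  - constructor 2; rewrite child_case /first_cell ?dE ?iE //.
    by rewrite /child dE.
  - by constructor 3; rewrite iE eqxx Ev.
  - by constructor 3; rewrite iE eqxx Ev.
  - constructor 2; rewrite child_case /first_cell ?dE -?iE //.
    by rewrite /child dE.
elim/cell_ind: x => [v|e i ik|e i /andP[ki iK]].
- case: y => [//|[e i]] /ve; rewrite cell_inr.
  by case=> ?; [constructor 1|constructor 3|constructor 4].
- elim/cell_ind: y => [v|e' j jk|e' j /andP[kj jK]].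
  + rewrite nadj_sym nadj_end // => /ve.
    by case=> ?; [constructor 2|constructor 4|constructor 3].
  + move=> adj; have [ee' ij] : e = e' /\ (i.+1 == j) || (j.+1 == i).
      move: adj; rewrite /cell /= (cell_val ik) (cell_val jk).
      by case/and4P => /eqP.
    move: jk {adj}; rewrite -{}ee' => jk; rewrite !npar_cell //.
    have [/eqP E'|/eqP E'] := orP ij; case: (dir e).
    * constructor 3; rewrite -E' ifN //; apply/eqP; nat_lia.
    * by constructor 4; rewrite -E'.
    * constructor 4; rewrite -E' ifN //; apply/eqP; nat_lia.
    * by constructor 3; rewrite -E'.
  + by rewrite /cell /= => /and4P[/eqP -> _]; rewrite inordK // ltnNge kj.
- by case: y => [w|[e' j]]; rewrite /cell /= /end_cell inordK // ltnNge ki /= ?andbF.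
Qed.

(** Sending each cell to the first end of its edge turns hops into connections in the original
    graph. *)
Lemma nodeZ_component :
  (forall w w', w \in Z -> w' \in Z -> connect (adj ends) w w' -> w = w') ->
  forall x y, x \in nodeZ -> y \in nodeZ -> connect nadj x y -> x = y.
Proof.
move=> Zc _ _ /imsetP[w wZ ->] /imsetP[w' w'Z ->] /connectP[p].
pose f (x : node) : V := match x with inl v => v | inr (e, _) => (ends e).1 end.
have fadj x y : nadj x y -> connect (adj ends) (f x) (f y).
  have ve v e i : end_cell v e i -> connect (adj ends) v (ends e).1.
    case/andP => _ /orP[] /andP[_ /eqP <-]; first exact: connect0.
    by rewrite (sym_connect_sym (@adj_sym _ _ ends)) connect1 // adj_ends.
  case: x => [v|[e i]]; case: y => [v'|[e' j]] //=.
  - exact: ve.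
  - by rewrite (sym_connect_sym (@adj_sym _ _ ends)); apply: ve.
  - by case/and4P => /eqP->; rewrite connect0.
have step x q : path nadj x q -> connect (adj ends) (f x) (f (last x q)).
  elim: q x => [|y q IH] x /=; first by rewrite connect0.
  by case/andP => /fadj xy /IH; apply: connect_trans.
by move=> /step /= + E'; rewrite -E' /= => /Zc ->.
Qed.

End Rooting.

End Grid.

(** * Allocations from the grid, with error of order [s / M] *)

Section GridAllocation.
Context {R : realType} {V E : finType} (ends : E -> V * V) (len : E -> R) (s : R).
Hypothesis s_gt0 : 0 < s.
Hypothesis s_len : forall e, s <= len e.
Local Notation point := (cake_pt R V E).

(** The integer part of [len e * M / s] works: it is at least [M], and rounding down lengthens the
    cells by a factor small enough because [s <= len e]. *)
Lemma grid_cells (M : nat) : (1 < M)%N -> forall e, exists k : nat,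
  [/\ (0 < k)%N & s / M%:R <= len e / k%:R <= s / M.-1%:R].
Proof.
move=> M1 e; have M0 : 0 < M%:R :> R by rewrite ltr0n; lia.
have Mp : M%:R = M.-1%:R + 1 :> R by rewrite natr1; congr _%:R; lia.
have Mp0 : 0 < M.-1%:R :> R by rewrite ltr0n; lia.
have sl := s_len e; have s0 := s_gt0.
pose x := len e * M%:R / s.
have x1 : M%:R <= x by rewrite ler_pdivlMr // mulrC ler_pM2r.
have x0 : 0 <= x by apply: le_trans x1; apply: ltW.
have /andP[k1 k2] := truncn_itv x0.
have kM : (M <= Num.truncn x)%N by rewrite -ltnS -(ltr_nat R); apply: le_lt_trans k2.
exists (Num.truncn x); move: (Num.truncn x) kM k1 k2 => k kM k1 k2.
have k0 : 0 < k%:R :> R by rewrite ltr0n; lia.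
split; first by lia.
apply/andP; split.
  rewrite ler_pdivrMr // mulrAC ler_pdivlMr // mulrC.
  by move: k1; rewrite /x ler_pdivlMr // [_ * s]mulrC.
rewrite ler_pdivrMr // mulrAC ler_pdivlMr //.
move: k2; rewrite -natr1 /x ltr_pdivrMr // Mp => k2; nra.
Qed.

Lemma grid_allocation (n N M : nat) (v : 'I_n -> set point -> R)
    (Q : 'I_n -> 'I_N -> set point) (Z : {set V}) :
  (2 < M)%N ->
  (forall i X Y, is_piece ends len X -> is_piece ends len Y -> X `<=` Y -> v i X <= v i Y) ->
  (forall i, s_separated ends len s (Q i)) ->
  ~ has_cycle_in ends (~: Z)%SET ->
  (forall w w', w \in Z -> w' \in Z -> connect (adj ends) w w' -> w = w') ->
  (minn (n + #|Z|) (2 * n - 1) <= N)%N ->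
  exists (C : 'I_n -> option E * {set V} * {set E}) (a b : 'I_n -> E -> R),
    let A i := subcake ends len (C i).1.1 (C i).1.2 (a i) (b i) in
    [/\ (forall i, valid_data ends len (C i).1.1 (C i).1.2 (C i).2 (a i) (b i)),
        (forall i, exists j, v i (Q i j) <= v i (A i)) &
        (forall i i', i != i' -> forall p q z, A i p -> A i' q ->
           dist_le ends len z p q -> s - 10%:R * (s / M%:R) <= z)].
Proof.
move=> M2 vmono Qsep Zac Zc nN.
have [k kP] := choice (grid_cells (ltnW M2)).
have k_gt0 e : (0 < k e)%N by case: (kP e).
have hc e : s / M%:R <= len e / (k e)%:R <= s / M.-1%:R by case: (kP e).
pose K := (\max_e k e)%N.
have k_leK e : (k e <= K)%N by apply: leq_bigmax.
have M0 : 0 < M%:R :> R by rewrite ltr0n; lia.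
have M10 : 0 < M.-1%:R :> R by rewrite ltr0n; lia.
have h_gt0 : 0 < s / M%:R by rewrite divr_gt0.
have h'_ge0 : 0 <= s / M.-1%:R by rewrite ltW // divr_gt0.
have [dir [d [d1 d2]]] := orientation_off Zac.
pose e_ := @nadj V E ends K k.
have esym : symmetric e_ by apply: nadj_sym.
pose par : @node V E K -> @node V E K := npar ends k Z dir.
have [depth depthP] := @depth_of_rank (@node V E K) par (nrank ends k dir d)
  (npar_rank k_gt0 k_leK d1).
pose carr := @carrier R V E ends len K k.
have data X : conn e_ X -> exists D : option E * {set V} * {set E} * (E -> R) * (E -> R),
    valid_data ends len D.1.1.1.1 D.1.1.1.2 D.1.1.2 D.1.2 D.2 /\
    subcake ends len D.1.1.1.1 D.1.1.1.2 D.1.2 D.2 = carr X.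
  move=> /(carrier_data s_gt0 s_len k_gt0 k_leK h_gt0 hc)[opt [W [F [a [b H]]]]].
  by exists (opt, W, F, a, b).
have carr_piece X : conn e_ X -> is_piece ends len (carr X).
  by move=> /data[D [[al bl _] <-]]; exact: subcake_piece.
(* Acceptable means worth at least one of the agent's own parts. *)
pose good i X := exists j, v i (Q i j) <= v i (carr X).
pose P i j := @round R V E ends len K k (Q i j).
have Qc i j : connected_piece ends len (Q i j) by have [] := Qsep i.
have P_conn i j : conn e_ (P i j).
  exact: (conn_round s_gt0 s_len k_gt0 k_leK h_gt0 hc).
(* Fewer than [M - 2] hops meet at most [M - 2] cells, of total length less than [s]. *)
have r0 : (0 < M - 2)%N by lia.
have hM : s / M.-1%:R * M.-1%:R = s by rewrite divfK // gt_eqF.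
have gmono i X Y : conn e_ X -> conn e_ Y -> X \subset Y -> good i X -> good i Y.
  move=> cX cY XY [j vj]; exists j; apply: (le_trans vj); apply: vmono.
  - exact: carr_piece.
  - exact: carr_piece.
  - exact: carrierS.
have Pgood i j : good i (P i j).
  exists j; apply: vmono; first by have [] := Qc i j.
    exact: carr_piece.
  by apply: (sub_carrier_round s_gt0 s_len k_gt0 k_leK h_gt0 hc); have [] := Qc i j.
have Psep i j j' : j != j' -> ~ close_sets e_ (M - 2) (P i j) (P i j').
  move=> jj' [x [y [m [/roundP[p [Qp xp]] /roundP[q [Qq yq]] mr [w [xw wy wm _]]]]]].
  have wM : ((size w).+1 < M.-1)%N by lia.
  have ws : (size w).+1%:R * (s / M.-1%:R) < s.
    by rewrite mulrC -[X in _ < X]hM ltr_pM2l ?divr_gt0 // ltr_nat.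
  have yq' : nset ends len k (last x w) q by rewrite wy.
  have D := path_dist_le s_gt0 s_len k_gt0 k_leK h_gt0 hc h'_ge0 xw xp yq' ws.
  have [_ /(_ j j' jj')[_ far]] := Qsep i.
  have : (s%:E <= Dist ends len p q)%E.
    apply: (le_trans far); apply: ereal_inf_lbound.
    by exists p => //; exists q.
  move/le_trans => /(_ _ (dist_le_Dist D)); rewrite lee_fin leNgt.
  by rewrite ws.
have cN : (minn (#|{: 'I_n}| + #|@nodeZ V E K Z|) (2 * #|{: 'I_n}| - 1) <= N)%N.
  by rewrite card_ord card_imset // => x y [].
have [A [A1 A2]] := discrete_allocation esym r0
   (npar_edge ends k_gt0 k_leK Z dir) (edge_npar k_leK d2) depthP gmono
   (nodeZ_component Zc) P_conn Pgood Psep cN.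
have [D DP] := choice (fun i => data (A i) (A1 i).1).
exists (fun i => (D i).1.1), (fun i => (D i).1.2), (fun i => (D i).2); split=> [i|i|i i' ii' p q z].
- by have [] := DP i.
- by have [_ ->] := DP i; have [_ []] := A1 i; move=> j vj; exists j.
have [_ ->] := DP i; have [_ ->] := DP i'.
move=> [x /= xA xp] [y /= yA yq] W; rewrite leNgt; apply/negP => zs.
have [m xy mb] := dist_le_joined s_gt0 s_len k_gt0 k_leK h_gt0 hc W xp yq.
apply: (A2 _ _ ii'); exists x, y, m; split=> //.
(* With [h = s / M], at least [M - 2] hops and [m * h <= z + 8 * h] give [z >= s - 10 * h]. *)
rewrite ltnNge; apply/negP => Mm.
have : (M - 2)%:R * (s / M%:R) <= m%:R * (s / M%:R) by rewrite ler_pM2r // ler_nat.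
rewrite natrB; last by lia.
have hM' : M%:R * (s / M%:R) = s by rewrite mulrC divfK // gt_eqF.
rewrite mulrBl hM'; move: zs mb h_gt0; move: (s / M%:R) => h; lra.
Qed.

End GridAllocation.

(** * Passing to the limit *)

Lemma ultra_constant (C : finType) (c : nat -> C) (G : set_system nat) :
  UltraFilter G -> exists c0, G [set m | c m = c0].
Proof.
move=> GU; apply: contrapT => no.
have : \forall m \near G, forall c0, c m <> c0.
  apply: filter_forall => c0; case: (in_ultra_setVsetC [set m | c m = c0] GU) => // H.
  by case: no; exists c0.
by move=> /filter_ex[m /(_ (c m))].
Qed.

Lemma ultra_limit (R : realType) (u : nat -> R) (b : R) (G : set_system nat) :
  UltraFilter G -> (forall m, 0 <= u m <= b) ->
  exists2 w, 0 <= w <= b & forall eps, 0 < eps -> G [set m | `|u m - w| < eps].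
Proof.
move=> GU ub; have GF : Filter G by apply: filter_filter.
have FG : ProperFilter (u @ G) by apply: fmap_proper_filter.
have [|w [wb wc]] := @segment_compact R 0 b (u @ G) FG.
  have uI m : u m \in `[0, b] by rewrite in_itv /= ub.
  exact: (@filterE _ G GF _ uI).
exists w; first by move: wb; rewrite /= in_itv.
move=> eps e0; case: (in_ultra_setVsetC [set m | `|u m - w| < eps] GU) => // H.
have H' : (u @ G) [set x | ~ (`|x - w| < eps)] by exact: H.
have nb : nbhs (w : R^o) (ball (w : R^o) eps) := nbhsx_ballx (w : R^o) eps e0.
have [x [/= nx]] := wc _ _ H' nb.
by rewrite /ball /= distrC.
Qed.

(** One ultrafilter refining the eventual filter serves all coordinates at once: the discrete one is
    constant along it and each bounded real one converges. *)
Lemma common_cluster_point (R : realType) (C J : finType) (c : nat -> C)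
    (u : nat -> J -> R) (b : J -> R) : (forall m j, 0 <= u m j <= b j) ->
  exists (c0 : C) (w : J -> R), (forall j, 0 <= w j <= b j) /\
    forall eps m0, 0 < eps -> exists m, [/\ (m0 <= m)%N, c m = c0 &
      forall j, `|u m j - w j| < eps].
Proof.
move=> ub; have [G [GU oG]] := ultraFilterLemma eventually_filter.
have [c0 cG] := ultra_constant c GU.
have lim j : exists w, 0 <= w <= b j /\
    forall eps, 0 < eps -> G [set m | `|u m j - w| < eps].
  by have [w ? ?] := ultra_limit GU (fun m => ub m j); exists w.
have [w wP] := choice lim; exists c0, w; split=> [j|eps m0 e0]; first by case: (wP j).
have big : G [set m | (m0 <= m)%N] by apply: oG; exists m0.
have all_j : \forall m \near G, forall j, `|u m j - w j| < eps.
  by apply: filter_forall => j; case: (wP j) => _; apply.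
by have [m [[? ?] ?]] := filter_ex (filterI (filterI big cG) all_j); exists m.
Qed.

(** * Dependence of a subcake on its lengths *)

Section Perturbation.
Context {R : realType} {V E : finType} (ends : E -> V * V) (len : E -> R) (s : R).
Hypothesis s_gt0 : 0 < s.
Hypothesis s_len : forall e, s <= len e.
Local Notation point := (cake_pt R V E).
Local Notation pt := (@pt_at R V E ends len).
Local Notation rep := (@rep R V E ends len).
Local Notation seg := (@seg R V E ends len).
Context (opt : option E) (W : {set V}) (delta : R).

Definition perturbed (a b a' b' : E -> R) : Prop :=
  [/\ forall e, 0 <= a e <= len e, forall e, 0 <= b e <= len e,
      forall e, 0 <= a' e <= len e, forall e, 0 <= b' e <= len e &
      forall e, `|a e - a' e| <= delta /\ `|b e - b' e| <= delta].

(** The parameter [t] is clamped to the interval given by [a'] and [b'], which moves it by at most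
    [delta]. *)
Lemma subcake_near a b a' b' p : perturbed a b a' b' -> subcake ends len opt W a b p ->
  exists2 p', subcake ends len opt W a' b' p' &
    p = p' \/ exists e t t', [/\ rep p e t, rep p' e t' & `|t - t'| <= delta].
Proof.
move=> [al bl al' bl' d]; rewrite /subcake; case: opt => [e|].
  move=> [t [tab tl] <-]; have [da db] := d e.
  have /andP[a'0 a'1] := al' e; have /andP[b'0 b'1] := bl' e.
  set lo := Num.min (a' e) (b' e); set hi := Num.max (a' e) (b' e).
  have lohi : lo <= hi by rewrite /lo /hi ge_min le_max lexx.
  have lo0 : 0 <= lo by rewrite le_min a'0.
  have hi1 : hi <= len e by rewrite ge_max a'1.
  pose t' := Num.max lo (Num.min t hi).
  have t'b : lo <= t' <= hi.
    by rewrite /t' le_max lexx /= ge_max lohi ge_min lexx orbT.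
  have t'l : 0 <= t' <= len e by case/andP: t'b => ? ?; apply/andP; split; lra.
  exists (pt e t'); first by exists t'.
  right; exists e, t, t'; split=> //.
  move: da db tab; rewrite !ler_norml => /andP[da1 da2] /andP[db1 db2] /andP[].
  rewrite ge_min le_max => t1 t2.
  have t1' : lo - delta <= t.
    rewrite /lo; case/orP: t1 => ?; rewrite lerBlDr ge_min; apply/orP; [left|right]; lra.
  have t2' : t <= hi + delta.
    by rewrite -lerBlDr /hi le_max; apply/orP; case/orP: t2 => ?; [left|right]; lra.
  rewrite /t'; clear t' t'b t'l; clearbody lo hi; case: (leP t hi) => thi; case: (leP lo _) => H; apply/andP; split; lra.
case=> [[w wW <-]|[e [t [pr H]]]].
  by exists (PV w); [left; exists w | left].
have [/andP[t0 t1] _] := pr; have [da db] := d e.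
have /andP[a'0 a'1] := al' e; have /andP[b'0 b'1] := bl' e.
case: H => -[eW te].
  have t'l : 0 <= Num.min t (a' e) <= len e by rewrite le_min t0 a'0 ge_min t1.
  exists (pt e (Num.min t (a' e))).
    right; exists e, (Num.min t (a' e)); split; first by split.
    by left; rewrite ge_min lexx orbT.
  right; exists e, t, (Num.min t (a' e)); split=> //.
  move: da; rewrite !ler_norml => /andP[da1 da2].
  by case: (leP t (a' e)) => H; apply/andP; split; lra.
have t'l : 0 <= Num.max t (b' e) <= len e by rewrite le_max t0 ge_max t1.
exists (pt e (Num.max t (b' e))).
  right; exists e, (Num.max t (b' e)); split; first by split.
  by right; rewrite le_max lexx orbT.
right; exists e, t, (Num.max t (b' e)); split=> //.
move: db; rewrite !ler_norml => /andP[db1 db2].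
by case: (leP t (b' e)) => H; apply/andP; split; lra.
Qed.

Lemma subcake_PE a b e t : 0 < t < len e -> subcake ends len opt W a b (PE e t) <->
  match opt with
  | Some e' => e' = e /\ Num.min (a e) (b e) <= t <= Num.max (a e) (b e)
  | None => ((ends e).1 \in W /\ t <= a e) \/ ((ends e).2 \in W /\ b e <= t)
  end.
Proof.
move=> tl; have tl' : 0 <= t <= len e by case/andP: tl => /ltW -> /ltW.
rewrite /subcake; case: opt => [e'|]; split.
- move=> [u [ub ul] E'].
  by have [E1 E2 _] := rep_PE s_gt0 s_len (conj ul E'); subst e' u.
- by move=> [-> tb]; exists t; rewrite ?pt_mid.
- case=> [[w _ //]|[e' [u [ur H]]]].
  by have [<- <- _] := rep_PE s_gt0 s_len ur.
- by move=> H; right; exists e, t; split=> //; split=> //; rewrite pt_mid.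
Qed.

(** Membership of an interior point of [e] can change only within [delta] of [a e] or of [b e]: two
    intervals of length [2 * delta] on each edge. *)
Lemma subcake_length a b a' b' : perturbed a b a' b' ->
  (cake_length len ((subcake ends len opt W a b `\` subcake ends len opt W a' b') `|`
                    (subcake ends len opt W a' b' `\` subcake ends len opt W a b))
     <= (\sum_(e : E) (4%:R * delta))%:E)%E.
Proof.
move=> [al bl al' bl' d]; set S := subcake _ _ _ _ a b; set S' := subcake _ _ _ _ a' b'.
rewrite /cake_length -sumEFin; apply: lee_sum => e _.
have [da db] := d e; have d0 : 0 <= delta by apply: le_trans da.
have sub : [set t | 0 < t < len e /\ ((S `\` S') `|` (S' `\` S)) (PE e t)] `<=`
    [set` `[a e - delta, a e + delta]] `|` [set` `[b e - delta, b e + delta]].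
  move=> t [tl]; rewrite /S /S' /= !in_itv /= !(subcake_PE _ _ tl).
  move: da db; rewrite !ler_norml => /andP[da1 da2] /andP[db1 db2].
  move=> H; have [inA|outA] := boolP (a e - delta <= t <= a e + delta); first by left.
  right; apply/negPn/negP => outB; move: outA outB; rewrite !negb_and -!ltNge => outA outB.
  have aa : (t <= a e) = (t <= a' e) by case/orP: outA => ?; apply/idP/idP => ?; lra.
  have bb : (b e <= t) = (b' e <= t) by case/orP: outB => ?; apply/idP/idP => ?; lra.
  have aa2 : (a e <= t) = (a' e <= t) by case/orP: outA => ?; apply/idP/idP => ?; lra.
  have bb2 : (t <= b e) = (t <= b' e) by case/orP: outB => ?; apply/idP/idP => ?; lra.
  case: opt H => [e'|]; rewrite ?ge_min ?le_max aa bb ?aa2 ?bb2; tauto.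
apply: (@le_trans _ _ (lebesgue_measure ([set` `[a e - delta, a e + delta]] `|`
    [set` `[b e - delta, b e + delta]] : set R))).
  (* Monotonicity of the outer measure, applied to the difference set as it is. *)
  exact: le_mu_ext.
apply: (@le_trans _ _ (lebesgue_measure ([set` `[(a e - delta)%R, (a e + delta)%R]] : set R) +
    lebesgue_measure ([set` `[(b e - delta)%R, (b e + delta)%R]] : set R))%E).
  by apply: measureU2; exact: measurable_itv.
rewrite !lebesgue_measure_itv /= !lte_fin.
by do 2!case: ifP => _; rewrite -?EFinB -?EFinD ?adde0 ?add0e lee_fin; lra.
Qed.

End Perturbation.

Section Limit.
Context {R : realType} {V E : finType} (ends : E -> V * V) (len : E -> R) (s : R).
Hypothesis s_gt0 : 0 < s.
Hypothesis s_len : forall e, s <= len e.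
Local Notation point := (cake_pt R V E).
Context (n : nat) (v : 'I_n -> set point -> R) (x : 'I_n -> R).
Hypothesis v_val : forall i, is_valuation ends len (v i).

Definition approx_allocation (eps : R) (C : 'I_n -> option E * {set V} * {set E})
    (a b : 'I_n -> E -> R) : Prop :=
  let A i := subcake ends len (C i).1.1 (C i).1.2 (a i) (b i) in
  [/\ (forall i, valid_data ends len (C i).1.1 (C i).1.2 (C i).2 (a i) (b i)),
      (forall i, x i - eps <= v i (A i)) &
      (forall i i', i != i' -> forall p q z, A i p -> A i' q ->
         dist_le ends len z p q -> s - eps <= z)].

Lemma dist_le_near z eps p q p' : dist_le ends len z p q -> z + eps < s ->
  p = p' \/ (exists e t t', [/\ rep ends len p e t, rep ends len p' e t' & `|t - t'| <= eps]) ->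
  0 <= eps -> dist_le ends len (z + eps) p' q.
Proof.
move=> W zs H e0; case: H => [<-|[e [t [t' [pr p'r tt]]]]].
  by apply: dist_le_mono W; lra.
have zt : z + `|t - t'| < s by lra.
have W' := dist_le_step s_gt0 s_len (dist_le_sym W) pr p'r zt.
by apply: dist_le_mono (dist_le_sym W'); lra.
Qed.

(** A cluster point of the allocations for [eps = 1 / (m + 1)]: the types are equal infinitely often
    and the lengths converge along the way. The value passes to the limit by continuity, and
    separation by moving points slightly. *)
Lemma approx_limit :
  (forall eps, 0 < eps -> exists C a b, approx_allocation eps C a b) ->
  exists C a b, approx_allocation 0 C a b.
Proof.
move=> H.
have seq_ex (m : nat) : exists D : ('I_n -> option E * {set V} * {set E}) *
    ('I_n -> E -> R) * ('I_n -> E -> R), approx_allocation (m.+1%:R^-1) D.1.1 D.1.2 D.2.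
  have [|C [a [b Cab]]] := H (m.+1%:R^-1); first by rewrite invr_gt0 ltr0n.
  by exists (C, a, b).
have [D DP] := choice seq_ex.
pose c m := [ffun i => (D m).1.1 i].
pose u m (j : 'I_n * E * bool) := if j.2 then (D m).1.2 j.1.1 j.1.2 else (D m).2 j.1.1 j.1.2.
have ub m j : 0 <= u m j <= len j.1.2.
  have [/(_ j.1.1)[al bl _] _ _] := DP m.
  by rewrite /u; case: j.2.
have [c0' [w [wb wP]]] := common_cluster_point c ub.
pose c0 : {ffun 'I_n -> option E * {set V} * {set E}} := c0'.
pose a i e := w (i, e, true); pose b i e := w (i, e, false).
have al i e : 0 <= a i e <= len e by apply: (wb (i, e, true)).
have bl i e : 0 <= b i e <= len e by apply: (wb (i, e, false)).
have near eps : 0 < eps -> exists m, [/\ m.+1%:R^-1 < eps, forall i, (D m).1.1 i = c0 i,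
    forall i, perturbed len eps (a i) (b i) ((D m).1.2 i) ((D m).2 i) &
    forall i, perturbed len eps ((D m).1.2 i) ((D m).2 i) (a i) (b i)].
  move=> e0; have [m [m0 mc mu]] := wP eps (Num.truncn eps^-1) e0.
  have me : m.+1%:R^-1 < eps.
    rewrite invf_plt ?posrE ?ltr0n //.
    have ei0 : 0 <= eps^-1 by rewrite invr_ge0 ltW.
    have /andP[_ lt] := truncn_itv ei0.
    by apply: (lt_le_trans lt); rewrite ler_nat.
  exists m; split=> // [i|i|i]; first by rewrite /c0 -mc ffunE.
    have [/(_ i)[al' bl' _] _ _] := DP m; split=> // e.
    by have := mu (i, e, true); have := mu (i, e, false); rewrite /u /= => h1 h2;
       rewrite distrC (ltW h2) distrC (ltW h1).
  have [/(_ i)[al' bl' _] _ _] := DP m; split=> // e.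
  by have := mu (i, e, true); have := mu (i, e, false); rewrite /u /= => h1 h2;
     rewrite (ltW h2) (ltW h1).
exists c0, a, b; split.
- move=> i; split=> // oN.
  have [m [_ mc _ _]] := near 1 ltr01.
  have [/(_ i)[_ _]] := DP m; rewrite mc => /(_ oN)[walk _] _ _.
  split=> // e eF.
  (* The equation [a e = len e] holds for every approximation of the limiting type, hence in the
     limit. *)
  have aE m' : (D m').1.1 i = c0 i -> (ends e).1 \in (c0 i).1.2 /\ (D m').1.2 i e = len e.
    by move=> mc'; have [/(_ i)[_ _]] := DP m'; rewrite mc' => /(_ oN)[_ /(_ e eF)].
  split; first by have [] := aE m (mc i).
  apply/eqP; apply/negPn/negP => ne.
  have d0 : 0 < `|a i e - len e| by rewrite normr_gt0 subr_eq0.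
  have [m' [_ mc' mp _]] := near (`|a i e - len e| / 2) (divr_gt0 d0 (ltr0n _ 2)).
  have [_ am'] := aE m' (mc' i).
  have [_ _ _ _ /(_ e)[da _]] := mp i; move: da; rewrite am'; lra.
- move=> i; rewrite subr0; apply/ler_addgt0Pr => eps e0.
  set S := subcake _ _ _ _ _ _.
  have SP : is_piece ends len S by apply: subcake_piece.
  have [_ _ cont _] := v_val i.
  have [del del0 delP] := cont S SP (eps / 2) (divr_gt0 e0 (ltr0n _ 2)).
  pose K : R := \sum_(e : E) 4%:R.
  have K0 : 0 <= K by apply: sumr_ge0.
  have K1 : 0 < K + 1 by rewrite ltr_wpDl.
  (* The second bound gives [K * dl <= K * del / (K + 1) < del]; dividing by [K + 1] also covers a
     graph without edges. *)
  pose dl := Num.min (eps / 2) (del / (K + 1)).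
  have dl0 : 0 < dl by rewrite lt_min !divr_gt0 ?ltr0n.
  have [m [me mc mp _]] := near dl dl0.
  have [/(_ i)[al' bl' _] /(_ i) vm _] := DP m.
  set Y := subcake _ _ _ _ _ _ in vm.
  have YP : is_piece ends len Y by apply: subcake_piece.
  have L := subcake_length ends s_gt0 s_len (c0 i).1.1 (c0 i).1.2 (mp i).
  have dd : `|v i S - v i Y| < eps / 2.
    apply: (delP Y YP); rewrite /S /Y mc; apply: (le_lt_trans L).
    rewrite lte_fin -mulr_suml -/K.
    apply: (@le_lt_trans _ _ (K * (del / (K + 1)))).
      by rewrite ler_wpM2l // ge_min lexx orbT.
    rewrite mulrA ltr_pdivrMr //.
    by rewrite mulrC ltr_pM2l // ltrDl ltr01.
  have me' : m.+1%:R^-1 < eps / 2.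
    by apply: (lt_le_trans me); rewrite ge_min lexx.
  move: dd; rewrite ltr_norml => /andP[]; move: vm me'.
  move: (v i S) (v i Y) (_^-1) => vS vY iM; lra.
move=> i i' ii' p q z Ap Aq W; rewrite subr0 leNgt; apply/negP => zs.
(* Moving both points costs [2 * eps] and the approximate separation loses less than one more, so
   [s < z + 3 * eps], against [z = s - 4 * eps]. *)
pose eps := (s - z) / 4%:R.
have e0 : 0 < eps by rewrite divr_gt0 // subr_gt0.
have zE : z = s - 4%:R * eps by rewrite /eps mulrC divfK // subKr.
clearbody eps.
have [m [me mc mp _]] := near eps e0.
have [_ _ sepm] := DP m.
have [p' Ap' pp'] := subcake_near (mp i) Ap.
have [q' Aq' qq'] := subcake_near (mp i') Aq.
have W1 : dist_le ends len (z + eps) p' q.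
  by apply: dist_le_near W _ pp' _; lra.
have W2 : dist_le ends len (z + eps + eps) q' p'.
  by apply: dist_le_near (dist_le_sym W1) _ qq' _; lra.
have := sepm i i' ii' p' q' (z + eps + eps).
rewrite !mc => /(_ Ap' Aq' (dist_le_sym W2)).
move: me; move: (_^-1) => iM; lra.
Qed.

Lemma approx_separated C a b : approx_allocation 0 C a b ->
  s_separated ends len s (fun i => subcake ends len (C i).1.1 (C i).1.2 (a i) (b i)).
Proof.
move=> [valid _ sep]; have con i := subcake_connected (valid i).
split=> // i i' ii'; split.
  apply/seteqP; split=> // p [Ap A'p]; have [Pi _] := con i.
  have D0 : dist_le ends len 0 p p.
    exact: dist_le0 (piece_cake s_gt0 s_len Pi Ap) (lexx 0).
  by have := sep i i' ii' p p 0 Ap A'p D0; rewrite subr0 leNgt s_gt0.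
apply/ereal_infP => _ [p Ap [q Aq <-]]; rewrite leNgt; apply/negP => lt.
have [z zs W] := Dist_dist_le s_gt0 s_len lt (lexx s).
by have := sep i i' ii' p q z Ap Aq W; rewrite subr0 leNgt zs.
Qed.

End Limit.

Theorem theorem5 (R : realType) (V E : finType) (ends : E -> V * V) (len : E -> R)
    (s : R) (n : nat) (v : 'I_n -> set (cake_pt R V E) -> R) :
  0 < s -> (1 <= n)%N ->
  (forall e : E, s <= len e) ->
  (forall a : V, (fvs_num ends (component ends a) <= 1)%N) ->
  (forall i, is_valuation ends len (v i)) ->
  let N := minn (n + fvs_num ends [set: V]) (2 * n - 1) in
  exists A : 'I_n -> set (cake_pt R V E),
    s_separated ends len s A /\
    forall i, (MMS ends len (v i) N s <= (v i (A i))%:E)%E.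
Proof.
move=> s0 n1 sl fvs1 vv N.
(* With no parts, the minimum in [MMS] would be [+oo]. *)
have N1 : (0 < N)%N by rewrite /N leq_min; lia.
have [Z [Zf Zac Zc]] := fvs_transversal fvs1.
have nN : (minn (n + #|Z|) (2 * n - 1) <= N)%N.
  by apply: minn_mono2; rewrite leq_add2l.
have len0 e : 0 <= len e by apply: le_trans (sl e); apply: ltW.
have mono i X Y : is_piece ends len X -> is_piece ends len Y -> X `<=` Y -> v i X <= v i Y.
  by have [_ H _ _] := vv i; apply: H.
(* The family of empty pieces is separated, which bounds the maximin share from below; the whole
   cake [top] bounds it from above. *)
have emptyP : s_separated ends len s (fun _ : 'I_N => (set0 : set (cake_pt R V E))).
  split=> [_|j j' _].
    split=> //; exists [::], finset.set0; split=> //.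
    by apply/seteqP; split=> // p [[ei /=]|[w /=]]; rewrite ?finset.inE.
  by rewrite setI0; split=> //; apply/ereal_infP => _ [p []].
pose top := subcake ends len None [set: V]%SET len len.
have topP : is_piece ends len top.
  by apply: subcake_piece => e; rewrite lexx len0.
have top_all X : is_piece ends len X -> X `<=` top.
  move=> XP p /(piece_cake s0 sl XP) [[w _ <-]|[e _ [t [_ tl] <-]]].
    by left; exists w; rewrite //= finset.inE.
  right; exists e, t; split=> //; left; rewrite finset.inE; split=> //.
  by case/andP: tl.
have mms_fin i : MMS ends len (v i) N s \is a fin_num.
  rewrite fin_real //; apply/andP; split.
    apply: (@lt_le_trans _ _ (v i set0)%:E); first by rewrite ltNyr.
    apply: le_trans (ereal_sup_ubound _); last by exists (fun=> set0).
    by apply: le_bigmin; rewrite ?leey.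
  apply: (@le_lt_trans _ _ (v i top)%:E); last by rewrite ltry.
  apply/ereal_supP => _ [P [Pc _] <-].
  apply: (@bigmin_inf _ _ _ _ (Ordinal N1)) => //; rewrite lee_fin.
  have [PP _] := Pc (Ordinal N1); apply: mono => //; exact: top_all.
pose x i := fine (MMS ends len (v i) N s).
have xE i : MMS ends len (v i) N s = (x i)%:E by rewrite fineK.
have approx eps : 0 < eps -> exists C a b, approx_allocation ends len s v x eps C a b.
  move=> e0.
  (* The supremum may not be attained, so each agent uses a partition that is optimal up to
     [eps]. *)
  have fam i : exists Q : 'I_N -> set (cake_pt R V E), s_separated ends len s Q /\
      forall j, x i - eps <= v i (Q j).
    have [_ [Q Qs <-] lt] := ub_ereal_sup_adherent e0 (mms_fin i).
    exists Q; split=> // j; rewrite -lee_fin; apply: ltW.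
    have -> : (x i - eps)%:E = (MMS ends len (v i) N s - eps%:E)%E by rewrite xE EFinB.
    by apply: (lt_le_trans lt); apply: bigmin_le.
  have [Q QP] := choice fam.
  (* Large enough for the separation error [10 * s / M] to be at most [eps]; [.+3] also ensures
     [2 < M]. *)
  pose M := (Num.truncn (10%:R * s / eps)).+3.
  have M2 : (2 < M)%N by [].
  have Ms : 10%:R * (s / M%:R) <= eps.
    rewrite mulrA ler_pdivrMr // [eps * _]mulrC -ler_pdivrMr //.
    have /andP[_ lt] := truncn_itv (ltW (divr_gt0 (mulr_gt0 (ltr0n _ 10) s0) e0)).
    by apply: le_trans (ltW lt) _; rewrite ler_nat /M; do 2!apply: leqW.
  have [C [a [b [valid val sep]]]] := grid_allocation s0 sl M2 mono (fun i => (QP i).1) Zac Zc nN.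
  exists C, a, b; split=> // [i|i i' ii' p q z Ap Aq W].
    by have [j vj] := val i; apply: le_trans vj; case: (QP i).
  by apply: le_trans (sep i i' ii' p q z Ap Aq W); rewrite lerB.
have [C [a [b ap]]] := approx_limit s0 sl vv approx.
exists (fun i => subcake ends len (C i).1.1 (C i).1.2 (a i) (b i)); split.
  exact: approx_separated ap.
by move=> i; rewrite xE lee_fin; have [_ /(_ i)] := ap; rewrite subr0.
Qed.
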